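(* Let $\mathfrak g_A=\mathbb Re_0\ltimes_A\mathbb R^5$ admit neither a left-invariant complex nor a left-invariant symplectic structure. Among the representatives $\rho=\exp(\mathbf i\omega)\wedge\Omega$ listed in the context (each considered under its case conditions and pattern restriction), the only ones that are closed occur in case 6b, at type $2$, with $$\alpha=-\lambda,\qquad\lambda\ne0.$$ Their matrices and generators are $$A=J_2(\lambda)\oplus(-\lambda)\oplus(-\lambda)\oplus(-\lambda),\qquad \rho=\exp(\mathbf ie^{15})\wedge(\mathbf ie^0+e^2)\wedge(e^3+\mathbf ie^4).$$ These Lie groups $G_A$ admit no lattice.
   Context: Notation. $\mathfrak g_A=\mathbb Re_0\ltimes_A\mathfrak h$, $\mathfrak h=\mathbb R^5$ an abelian ideal with basis $e_1,\dots,e_5$, $[e_0,v]=Av$; $G_A$ is the simply connected Lie group with Lie algebra $\mathfrak g_A$; a lattice is a discrete cocompact subgroup; $e^0,\dots,e^5$ is the dual basis and $e^{i_1\cdots i_r}=e^{i_1}\wedge\cdots\wedge e^{i_r}$. All parameters are real. The differential on $\bigwedge^\bullet\mathfrak g_A^*$ is the derivation with $\mathrm d\xi(X,Y)=-\xi([X,Y])$; thus $\mathrm de^0=0$ and $\mathrm de^p=-e^0\wedge A^Te^p$ with $A^Te^p=\sum_i a_{pi}e^i$. $J_r(t)$ is the $r\times r$ Jordan block with eigenvalue $t$ and ones on the superdiagonal, $C(a,b)=\begin{pmatrix}a&-b\\ b&a\end{pmatrix}$ with $b\ne0$, and a scalar summand is a $1\times1$ block. The coframe is ordered by the displayed matrix.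 Products of forms are wedge products and $\eta=e^1+\mathbf ie^2$. Representatives (case, conditions; type: $\Omega$; $\omega$): - Case 4: $A=J_3(\lambda)\oplus\mu\oplus\nu$, $\lambda=0$, $\mu=\nu$. Type 1: $e^4+\mathbf ie^5$; $e^{01}+e^{23}$. Type 2: $(\mathbf ie^0+e^3)(e^4+\mathbf ie^5)$; $e^{12}$. - Case 5: $A=J_2(\lambda)\oplus J_2(\mu)\oplus\nu$, $\mu=0$, $\nu=\lambda$. Type 1: $e^2+\mathbf ie^5$; $e^{01}+e^{34}$. Type 2: $(e^0+e^1+\mathbf ie^5)(\mathbf ie^0+e^2)$; $e^{34}$. - Case 6a: $A=J_2(\lambda)\oplus\mu\oplus\nu\oplus\gamma$, $\mu=\lambda$, $\gamma=-\nu$. Type 1: $e^2+\mathbf ie^3$; $e^{01}+e^{45}$. Type 2: $(e^0+e^1+\mathbf ie^3)(\mathbf ie^0+e^2)$; $e^{45}$. - Case 6b: $A=J_2(\lambda)\oplus\mu\oplus\nu\oplus\gamma$, $\mu=\nu=\alpha$, $\gamma=-\lambda$. Type 1: $e^3+\mathbf ie^4$; $e^{01}+e^{25}$. Type 2: $(\mathbf ie^0+e^2)(e^3+\mathbf ie^4)$; $e^{15}$. - Case 6c: $A=J_2(\lambda)\oplus\mu\oplus\nu\oplus\gamma$, $\lambda=0$, $\mu=\nu$. Type 1: $e^3+\mathbf ie^4$; $e^{05}+e^{12}$. - Case 7: $A=C(a,b)\oplus J_3(\lambda)$, $b\ne0$, $\lambda=0$. Type 1: $e^0+\eta$; $e^{12}+e^{03}+e^{45}$.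 Type 2: $\eta(e^0-\mathbf ie^5)$; $e^{34}$. - Case 8a: $A=C(a,b)\oplus J_2(\lambda)\oplus\mu$, $b\ne0$, $\lambda+\mu=0$. Type 1: $e^0+\eta$; $e^{12}+e^{03}+e^{45}$. Type 2: $\eta(e^0-\mathbf ie^4)$; $e^{35}$. - Case 8b: $A=C(a,b)\oplus J_2(\lambda)\oplus\mu$, $b\ne0$, $\lambda=0$. Type 1: $e^0+\eta$; $e^{12}+e^{34}+e^{05}$. Type 2: $\eta(e^0-\mathbf ie^5)$; $e^{34}$. - Case 9: $A=C(a,b)\oplus\lambda\oplus\mu\oplus\nu$, $b\ne0$, $\lambda+\mu=0$. Type 1: $e^0+\eta$; $e^{34}+e^{05}$. Type 2: $\eta(e^0-\mathbf ie^5)$; $e^{34}$. - Case 10: $A=\mathrm{diag}(\lambda,\lambda,\mu,\zeta,-\zeta)$. Type 1: $e^1+\mathbf ie^2$; $e^{03}+e^{45}$. Type 2: $(e^1+\mathbf ie^2)(e^0+\mathbf ie^3)$; $e^{45}$. Pattern restrictions, also in force (they express the absence of invariant complex and symplectic structures). Eigenvalue lists are multisets; two identical pairs means four entries grouped as $\{r,r\},\{s,s\}$ and two opposite pairs means four entries grouped as $\{r,-r\},\{s,-s\}$, using disjoint occurrences (two zeros form an opposite pair). - (4) $J_3(\lambda)\oplus\mu\oplus\nu$: $\lambda\ne0$ or $\mu\ne-\nu$. - (5) $J_2(\lambda)\oplus J_2(\mu)\oplus\nu$: $\lambda\ne\pm\mu$ and $\{\lambda,\mu,\nu\}\ne\{0,-\alpha,\alpha\}$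 for every $\alpha\in\mathbb R$. - (6) $J_2(\lambda)\oplus\mu\oplus\nu\oplus\gamma$: $\{\lambda,\mu,\nu,\gamma\}$ contains neither two identical pairs nor two opposite pairs; if $\lambda=0$, $\{\mu,\nu,\gamma\}$ also contains no opposite pair. - (7) $C(a,b)\oplus J_3(\lambda)$: $(a,\lambda)\ne(0,0)$. - (8) $C(a,b)\oplus J_2(\lambda)\oplus\mu$: $\lambda\ne\mu$; if $a=0$, also $\lambda\ne-\mu$ and $\lambda\ne0$. - (9) $C(a,b)\oplus\lambda\oplus\mu\oplus\nu$: $\{\lambda,\mu,\nu\}$ contains no identical pair; if $a=0$, also no opposite pair. - (10) diagonal $A$: the spectrum contains neither two identical pairs nor two opposite pairs. *)

(* Defs.v *)
Set Warnings "-notation-overridden,-ambiguous-paths,-notation-incompatible-prefix".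
From HB Require Import structures.
From mathcomp Require Export all_boot all_order all_algebra.
From mathcomp Require Export complex.
From mathcomp Require Export all_classical all_reals all_analysis.
Export Order.TTheory GRing.Theory Num.Theory.
Export numFieldNormedType.Exports.

Set Implicit Arguments.
Unset Strict Implicit.
Unset Printing Implicit Defensive.

Local Open Scope ring_scope.
Local Open Scope complex_scope.
Local Open Scope quotient_scope.

Definition dsum (K : pzRingType) (m n : nat) (A : 'M[K]_m) (B : 'M[K]_n) :
  'M[K]_(m + n) := block_mx A 0 0 B.

Notation "A ⊕ B" := (dsum A B) (at level 45, right associativity) : ring_scope.

Definition jordan (K : pzRingType) (r : nat) (t : K) : 'M[K]_r :=
  \matrix_(i < r, j < r) (t *+ (i == j) + (i.+1 == j :> nat)%:R).

Definition Cmx (K : pzRingType) (a b : K) : 'M[K]_2 :=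
  \matrix_(i < 2, j < 2)
    (if i == j then a else if (i < j)%N then - b else b).

Definition blk1 (K : pzRingType) (t : K) : 'M[K]_1 := t%:M.

(* An element of the Lie algebra g_A is the column of its coordinates in the
   basis e_0, e_1, ..., e_5; the tail, of type 'cV_5, is the component in the
   abelian ideal h. *)

Definition e0coord (K : pzRingType) (X : 'cV[K]_6) : K := X ord0 0.
Definition hpart (K : pzRingType) (X : 'cV[K]_6) : 'cV[K]_5 :=
  @dsubmx K 1 5 1 X.

Definition bracket (K : pzRingType) (A : 'M[K]_5) (X Y : 'cV[K]_6) : 'cV[K]_6 :=
  @col_mx K 1 5 1 0 (e0coord X *: (A *m hpart Y) - e0coord Y *: (A *m hpart X)).

Definition bvec (K : pzRingType) (i : 'I_6) : 'cV[K]_6 := delta_mx i 0.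

(* A form on g_A is the family of its coefficients on the monomials
   e^S = e^{i_1} /\ ... /\ e^{i_r}, S = {i_1 < ... < i_r}. *)

Notation form K := {ffun {set 'I_6} -> K^o}.

Definition monomial (K : pzRingType) (S : {set 'I_6}) : form K :=
  [ffun T : {set 'I_6} => (T == S)%:R].

(* e^S /\ e^T = (-1)^(inversions S T) e^(S :|: T) for disjoint S and T. *)
Definition inversions (S T : {set 'I_6}) : nat :=
  #|[set p : 'I_6 * 'I_6 | [&& p.1 \in S, p.2 \in T & (p.2 < p.1)%N]]|.

Definition wedge (K : pzRingType) (a b : form K) : form K :=
  [ffun U : {set 'I_6} => \sum_(S : {set 'I_6} | S \subset U)
     (-1) ^+ inversions S (U :\: S) * (a S * b (U :\: S))].

Notation "a ∧ b" := (wedge a b) (at level 40, left associativity) : ring_scope.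

Notation "\e_ i" := (monomial _ (finset.set1 (inord i)))
  (at level 8, i at level 2, format "\e_ i") : ring_scope.

(* The powers of a are wedge powers.  The sum is the full exponential series
   whenever a has no component of degree 0, since then a^7 = 0. *)
Definition expform (K : fieldType) (a : form K) : form K :=
  \sum_(k < 7) k`!%:R^-1 *: iter k (wedge a) (monomial K finset.set0).

(* d xi (X, Y) = - xi ([X, Y]) for xi = e^p. *)
Definition dcovec (K : pzRingType) (A : 'M[K]_5) (p : 'I_6) : form K :=
  \sum_(i < 6) \sum_(j < 6 | (i < j)%N)
    (- bracket A (bvec K i) (bvec K j) p 0) *: monomial K [set i; j]%SET.

(* The extension of dcovec as a graded derivation: for S = {i_1 < ... < i_r},
   d e^S is the sum over q of
   (-1)^(q-1) e^{i_1 ... i_{q-1}} /\ d e^{i_q} /\ e^{i_{q+1} ... i_r}. *)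
Definition dform (K : pzRingType) (A : 'M[K]_5) (a : form K) : form K :=
  \sum_(S : {set 'I_6}) a S *: \sum_(k in S)
    (-1) ^+ #|[set i in S | (i < k)%N]%SET| *:
      (monomial K [set i in S | (i < k)%N]%SET ∧ dcovec A k
         ∧ monomial K [set i in S | (k < i)%N]%SET).

Definition complex_structure (R : realType) (A : 'M[R]_5) (J : 'M[R]_6) : Prop :=
  J *m J = - 1%:M /\
  forall X Y : 'cV[R]_6,
    bracket A (J *m X) (J *m Y) - J *m bracket A (J *m X) Y
      - J *m bracket A X (J *m Y) - bracket A X Y = 0.

Definition eval2 (R : realType) (w : form R) (X Y : 'cV[R]_6) : R :=
  \sum_(i < 6) \sum_(j < 6 | (i < j)%N)
    w [set i; j]%SET * (X i 0 * Y j 0 - X j 0 * Y i 0).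

Definition symplectic_structure (R : realType) (A : 'M[R]_5) (w : form R) : Prop :=
  [/\ forall S : {set 'I_6}, #|S| != 2%N -> w S = 0,
      dform A w = 0
    & forall X : 'cV[R]_6, (forall Y, eval2 w X Y = 0) -> X = 0].

Definition spinor (R : realType) (Omega omega : form R[i]) : form R[i] :=
  expform ('i%C *: omega) ∧ Omega.

Definition form_closed (R : realType) (A : 'M[R]_5) (rho : form R[i]) : Prop :=
  dform (map_mx (real_complex R) A) rho = 0.

Inductive family (R : realType) : Type :=
| J3_1_1 of R & R & R
| J2_J2_1 of R & R & R
| J2_1_1_1 of R & R & R & R
| C_J3 of R & R & R
| C_J2_1 of R & R & R & R
| C_1_1_1 of R & R & R & R & R
| Diagonal of R & R & R & R & R.

Definition family_mx (R : realType) (F : family R) : 'M[R]_5 :=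
  match F with
  | J3_1_1 lambda mu nu => jordan 3 lambda ⊕ blk1 mu ⊕ blk1 nu
  | J2_J2_1 lambda mu nu => jordan 2 lambda ⊕ jordan 2 mu ⊕ blk1 nu
  | J2_1_1_1 lambda mu nu gamma =>
      jordan 2 lambda ⊕ blk1 mu ⊕ blk1 nu ⊕ blk1 gamma
  | C_J3 a b lambda => Cmx a b ⊕ jordan 3 lambda
  | C_J2_1 a b lambda mu => Cmx a b ⊕ jordan 2 lambda ⊕ blk1 mu
  | C_1_1_1 a b lambda mu nu => Cmx a b ⊕ blk1 lambda ⊕ blk1 mu ⊕ blk1 nu
  | Diagonal d1 d2 d3 d4 d5 =>
      blk1 d1 ⊕ blk1 d2 ⊕ blk1 d3 ⊕ blk1 d4 ⊕ blk1 d5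
  end.

(* Lists up to permutation are multisets. *)
Definition submultiset (T : eqType) (s l : seq T) : Prop :=
  exists t, perm_eq l (s ++ t).

Definition identical_pair (R : realType) (l : seq R) : Prop :=
  exists r, submultiset [:: r; r] l.
Definition opposite_pair (R : realType) (l : seq R) : Prop :=
  exists r, submultiset [:: r; - r] l.
Definition two_identical_pairs (R : realType) (l : seq R) : Prop :=
  exists r s, submultiset [:: r; r; s; s] l.
Definition two_opposite_pairs (R : realType) (l : seq R) : Prop :=
  exists r s, submultiset [:: r; - r; s; - s] l.

Definition pattern (R : realType) (F : family R) : Prop :=
  match F with
  | J3_1_1 lambda mu nu => lambda <> 0 \/ mu <> - nu
  | J2_J2_1 lambda mu nu =>
      [/\ lambda <> mu, lambda <> - mu
        & forall alpha, ~ perm_eq [:: lambda; mu; nu] [:: 0; - alpha; alpha]]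
  | J2_1_1_1 lambda mu nu gamma =>
      [/\ ~ two_identical_pairs [:: lambda; mu; nu; gamma],
          ~ two_opposite_pairs [:: lambda; mu; nu; gamma]
        & lambda = 0 -> ~ opposite_pair [:: mu; nu; gamma]]
  | C_J3 a b lambda => (a, lambda) <> (0, 0)
  | C_J2_1 a b lambda mu =>
      lambda <> mu /\ (a = 0 -> lambda <> - mu /\ lambda <> 0)
  | C_1_1_1 a b lambda mu nu =>
      ~ identical_pair [:: lambda; mu; nu] /\
      (a = 0 -> ~ opposite_pair [:: lambda; mu; nu])
  | Diagonal d1 d2 d3 d4 d5 =>
      ~ two_identical_pairs [:: d1; d2; d3; d4; d5] /\
      ~ two_opposite_pairs [:: d1; d2; d3; d4; d5]
  end.

(* [representative c k F Omega omega]: in case c, the generator of type k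
   listed for the matrix [family_mx F] is exp(i omega) /\ Omega. *)

Inductive case_label : Set :=
  Case4 | Case5 | Case6a | Case6b | Case6c | Case7 | Case8a | Case8b
| Case9 | Case10.

Definition eta (R : realType) : form R[i] := \e_1 + 'i%C *: \e_2.

Inductive representative (R : realType) :
    case_label -> nat -> family R -> form R[i] -> form R[i] -> Prop :=
| Rep4_1 lambda mu nu of lambda = 0 & mu = nu :
    representative Case4 1%N (J3_1_1 lambda mu nu)
      (\e_4 + 'i%C *: \e_5)
      (\e_0 ∧ \e_1 + \e_2 ∧ \e_3)
| Rep4_2 lambda mu nu of lambda = 0 & mu = nu :
    representative Case4 2%N (J3_1_1 lambda mu nu)
      (('i%C *: \e_0 + \e_3) ∧ (\e_4 + 'i%C *: \e_5))
      (\e_1 ∧ \e_2)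
| Rep5_1 lambda mu nu of mu = 0 & nu = lambda :
    representative Case5 1%N (J2_J2_1 lambda mu nu)
      (\e_2 + 'i%C *: \e_5)
      (\e_0 ∧ \e_1 + \e_3 ∧ \e_4)
| Rep5_2 lambda mu nu of mu = 0 & nu = lambda :
    representative Case5 2%N (J2_J2_1 lambda mu nu)
      ((\e_0 + \e_1 + 'i%C *: \e_5) ∧ ('i%C *: \e_0 + \e_2))
      (\e_3 ∧ \e_4)
| Rep6a_1 lambda mu nu gamma of mu = lambda & gamma = - nu :
    representative Case6a 1%N (J2_1_1_1 lambda mu nu gamma)
      (\e_2 + 'i%C *: \e_3)
      (\e_0 ∧ \e_1 + \e_4 ∧ \e_5)
| Rep6a_2 lambda mu nu gamma of mu = lambda & gamma = - nu :
    representative Case6a 2%N (J2_1_1_1 lambda mu nu gamma)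
      ((\e_0 + \e_1 + 'i%C *: \e_3) ∧ ('i%C *: \e_0 + \e_2))
      (\e_4 ∧ \e_5)
| Rep6b_1 lambda mu nu gamma alpha of
    mu = alpha & nu = alpha & gamma = - lambda :
    representative Case6b 1%N (J2_1_1_1 lambda mu nu gamma)
      (\e_3 + 'i%C *: \e_4)
      (\e_0 ∧ \e_1 + \e_2 ∧ \e_5)
| Rep6b_2 lambda mu nu gamma alpha of
    mu = alpha & nu = alpha & gamma = - lambda :
    representative Case6b 2%N (J2_1_1_1 lambda mu nu gamma)
      (('i%C *: \e_0 + \e_2) ∧ (\e_3 + 'i%C *: \e_4))
      (\e_1 ∧ \e_5)
| Rep6c_1 lambda mu nu gamma of lambda = 0 & mu = nu :
    representative Case6c 1%N (J2_1_1_1 lambda mu nu gamma)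
      (\e_3 + 'i%C *: \e_4)
      (\e_0 ∧ \e_5 + \e_1 ∧ \e_2)
| Rep7_1 a b lambda of b <> 0 & lambda = 0 :
    representative Case7 1%N (C_J3 a b lambda)
      (\e_0 + eta R)
      (\e_1 ∧ \e_2 + \e_0 ∧ \e_3 + \e_4 ∧ \e_5)
| Rep7_2 a b lambda of b <> 0 & lambda = 0 :
    representative Case7 2%N (C_J3 a b lambda)
      (eta R ∧ (\e_0 - 'i%C *: \e_5))
      (\e_3 ∧ \e_4)
| Rep8a_1 a b lambda mu of b <> 0 & lambda + mu = 0 :
    representative Case8a 1%N (C_J2_1 a b lambda mu)
      (\e_0 + eta R)
      (\e_1 ∧ \e_2 + \e_0 ∧ \e_3 + \e_4 ∧ \e_5)
| Rep8a_2 a b lambda mu of b <> 0 & lambda + mu = 0 :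
    representative Case8a 2%N (C_J2_1 a b lambda mu)
      (eta R ∧ (\e_0 - 'i%C *: \e_4))
      (\e_3 ∧ \e_5)
| Rep8b_1 a b lambda mu of b <> 0 & lambda = 0 :
    representative Case8b 1%N (C_J2_1 a b lambda mu)
      (\e_0 + eta R)
      (\e_1 ∧ \e_2 + \e_3 ∧ \e_4 + \e_0 ∧ \e_5)
| Rep8b_2 a b lambda mu of b <> 0 & lambda = 0 :
    representative Case8b 2%N (C_J2_1 a b lambda mu)
      (eta R ∧ (\e_0 - 'i%C *: \e_5))
      (\e_3 ∧ \e_4)
| Rep9_1 a b lambda mu nu of b <> 0 & lambda + mu = 0 :
    representative Case9 1%N (C_1_1_1 a b lambda mu nu)
      (\e_0 + eta R)
      (\e_3 ∧ \e_4 + \e_0 ∧ \e_5)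
| Rep9_2 a b lambda mu nu of b <> 0 & lambda + mu = 0 :
    representative Case9 2%N (C_1_1_1 a b lambda mu nu)
      (eta R ∧ (\e_0 - 'i%C *: \e_5))
      (\e_3 ∧ \e_4)
| Rep10_1 lambda mu zeta :
    representative Case10 1%N (Diagonal lambda lambda mu zeta (- zeta))
      (\e_1 + 'i%C *: \e_2)
      (\e_0 ∧ \e_3 + \e_4 ∧ \e_5)
| Rep10_2 lambda mu zeta :
    representative Case10 2%N (Diagonal lambda lambda mu zeta (- zeta))
      ((\e_1 + 'i%C *: \e_2) ∧ (\e_0 + 'i%C *: \e_3))
      (\e_4 ∧ \e_5).

(* The simply connected Lie group with Lie algebra g_A is realized as the
   manifold R x R^5, with its product topology, under the group law
   (t, v) (s, w) = (t + s, v + exp(t A) w). *)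

Definition mexp (R : realType) (A : 'M[R]_5) : 'M[R]_5 :=
  lim (series (fun n : nat => n`!%:R^-1 *: A ^+ n) @ \oo)%classic.

Notation GA R := (R * 'cV[R]_5)%type.

Definition Gone (R : realType) : GA R := (0, 0).
Definition Gmul (R : realType) (A : 'M[R]_5) (x y : GA R) : GA R :=
  (x.1 + y.1, x.2 + mexp (x.1 *: A) *m y.2).
Definition Ginv (R : realType) (A : 'M[R]_5) (x : GA R) : GA R :=
  (- x.1, - (mexp (- x.1 *: A) *m x.2)).

Definition Gsubgroup (R : realType) (A : 'M[R]_5) (Gamma : set (GA R)) : Prop :=
  [/\ Gamma (Gone R),
      forall x y, Gamma x -> Gamma y -> Gamma (Gmul A x y)
    & forall x, Gamma x -> Gamma (Ginv A x)].

Section CosetSpace.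
Context {R : realType} (A : 'M[R]_5) (Gamma : set (GA R)).

Definition Gcoset (x : GA R) : set (GA R) :=
  [set Gmul A g x | g in Gamma]%classic.

Definition same_coset : rel (GA R) := fun x y => `[< Gcoset x = Gcoset y >].

Lemma same_coset_equiv : equiv_class_of same_coset.
Proof.
split=> [x|x y|y x z] /=.
- exact/asboolP.
- by apply: asbool_equiv_eq; split=> ->.
- by move=> /asboolP exy /asboolP eyz; apply/asboolP; rewrite exy.
Qed.

Canonical same_coset_equiv_rel := EquivRelPack same_coset_equiv.

Definition coset_space : topologicalType :=
  quotient_topology {eq_quot same_coset_equiv_rel}.

End CosetSpace.

(* Cocompactness is compactness of the quotient topology on the space of
   cosets Gamma x. *)
Definition lattice (R : realType) (A : 'M[R]_5) (Gamma : set (GA R)) : Prop :=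
  [/\ Gsubgroup A Gamma,
      (Gamma `<=` isolated Gamma)%classic
    & compact [set: coset_space A Gamma]%classic].

(* Main.v *)
Require Import Defs.
From mathcomp Require Import ring lra.

(** Why the statement holds.

    Closedness. The form [exp (i omega) /\ Omega] starts with [Omega], and [d]
    raises the degree by one, so it can be closed only if [d Omega = 0]
    ([closed_covector], [closed_bivector]). In the monomial basis [d] is
    [- e^0 /\ D], where [D] is the derivation extending the transpose of
    [ad e_0]; on covectors and on decomposable two-forms this is an explicit
    linear condition ([dform1E], [dform2E]). For every listed representative one
    coefficient of [d Omega] is enough: it is nonzero because of the rotation
    block, or it forces a coincidence among the eigenvalues that the pattern
    restrictions exclude ([closed_representative]). The only survivor has the
    matrix [J_2(l) + (- l) + (- l) + (- l)] with [l != 0]. There the spinor is a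
    combination of monomials that contain [e^0] or whose covectors span an
    invariant subspace of trace zero, so that [d] kills it
    ([dform_invariant_monomial], [exceptional_closed]).

    Structures. A complex structure would have to commute with [ad e_0] on a
    hyperplane of the ideal, which is incompatible with [ad e_0] being scalar up
    to maps of rank one with image the line of [e_1] ([no_complex_blk]). For a
    closed two-form, [e_1], [e_3] and [e_4] pair trivially with all basis
    vectors but [e_0] and [e_2], so the form is degenerate ([no_symplectic_blk]).

    Lattices. A group with a lattice is unimodular, but here [ad e_0] has trace
    [- l]. Instead of a Haar measure the proof uses the lattice of translations
    contained in a lattice of the group. Cocompactness enters through the
    boundedness of continuous invariant functions ([invariant_bounded]): it
    provides an element moving the first coordinate by [t != 0]
    ([translation_part_neq0]) and shows that the translations span the ideal
    ([translations_span]). Discreteness makes them commensurable with the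
    integer span of a basis ([translations_commensurable]), so that
    [exp (t A)], which preserves them, has determinant of absolute value at least
    one ([lattice_det_ge1]); so has its inverse, a contradiction. *)

Set Implicit Arguments.
Unset Strict Implicit.
Unset Printing Implicit Defensive.

Local Open Scope ring_scope.
Local Open Scope complex_scope.

(** * Exterior algebra on the monomial basis *)

Section Exterior.
Import mathcomp.boot.finset.
Variable K : comNzRingType.
Implicit Types (a b c : form K) (S T U : {set 'I_6}).
Local Notation "''e^' S" := (monomial K S) (at level 8, S at level 2).

Lemma formZ (k : K) a U : (k *: a) U = k * a U.
Proof. by rewrite ffunE. Qed.

Lemma formD a b U : (a + b) U = a U + b U.
Proof. by rewrite ffunE. Qed.

Lemma formN a U : (- a) U = - a U.
Proof. by rewrite ffunE. Qed.

(** Only the splitting [U = S :|: (U :\: S)] contributes to the coefficient of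
    [e^U], and it exists exactly when [U] is the disjoint union of [S] and [T]. *)
Lemma wedge_monomial S T : 'e^S ∧ 'e^T =
  if [disjoint S & T] then (-1) ^+ inversions S T *: 'e^(S :|: T) else 0.
Proof.
apply/ffunP => U; rewrite ffunE.
have [SU|nSU] := boolP (S \subset U).
  rewrite (bigD1 S) //= big1 ?addr0 => [|S' /andP[_ /negPf S'S]]; last first.
    by rewrite ffunE S'S mul0r mulr0.
  rewrite !ffunE eqxx mul1r; have [UST|UST] := eqVneq (U :\: S) T.
    have -> : [disjoint S & T] by rewrite -UST disjoints_subset setCD subsetUr.
    rewrite !ffunE -UST.
    have -> : S :|: U :\: S = U by rewrite setDE setUIr setUCr setIT (setUidPr SU).
    by rewrite eqxx mulr1 [RHS]mulr1.
  case: ifP => [ST|_]; rewrite !ffunE ?mulr0 //.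
  case: eqP => [UE|]; last by rewrite scaler0.
  case/eqP: UST; rewrite UE setDUl setDv set0U.
  by apply/setDidPl; rewrite disjoint_sym.
rewrite big1 => [|S' S'U]; last first.
  rewrite ffunE; case: eqP => [E|]; last by rewrite mul0r mulr0.
  by rewrite -E S'U in nSU.
case: ifP => [ST|_]; rewrite !ffunE //.
case: eqP => [UE|]; last by rewrite scaler0.
by rewrite UE subsetUl in nSU.
Qed.

Lemma wedgeDl a b c : (a + b) ∧ c = a ∧ c + b ∧ c.
Proof.
apply/ffunP => U; rewrite !ffunE -big_split; apply: eq_bigr => S _.
by rewrite ffunE mulrDl mulrDr.
Qed.

Lemma wedgeDr a b c : a ∧ (b + c) = a ∧ b + a ∧ c.
Proof.
apply/ffunP => U; rewrite !ffunE -big_split; apply: eq_bigr => S _.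
by rewrite ffunE !mulrDr.
Qed.

Lemma wedgeZl (k : K) a b : (k *: a) ∧ b = k *: (a ∧ b).
Proof.
apply/ffunP => U; rewrite !ffunE scaler_sumr; apply: eq_bigr => S _.
by rewrite ffunE -!mulrA [_ *: _]mulrCA.
Qed.

Lemma wedgeZr (k : K) a b : a ∧ (k *: b) = k *: (a ∧ b).
Proof.
apply/ffunP => U; rewrite !ffunE scaler_sumr; apply: eq_bigr => S _.
by rewrite ffunE [k *: (_ * _)]mulrCA; congr (_ * _); rewrite [a S * _]mulrCA.
Qed.

Lemma wedge0l a : 0 ∧ a = 0.
Proof. by rewrite -[0](scale0r (0 : form K)) wedgeZl !scale0r. Qed.

Lemma wedge0r a : a ∧ 0 = 0.
Proof. by rewrite -[0](scale0r (0 : form K)) wedgeZr !scale0r. Qed.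

Lemma wedge_suml I (r : seq I) (P : pred I) (F : I -> form K) b :
  (\sum_(i <- r | P i) F i) ∧ b = \sum_(i <- r | P i) (F i ∧ b).
Proof. by apply: (big_morph (fun a => a ∧ b)) => [x y|]; rewrite ?wedgeDl ?wedge0l. Qed.

Lemma wedge_sumr I (r : seq I) (P : pred I) (F : I -> form K) b :
  b ∧ (\sum_(i <- r | P i) F i) = \sum_(i <- r | P i) (b ∧ F i).
Proof. by apply: (big_morph (fun a => b ∧ a)) => [x y|]; rewrite ?wedgeDr ?wedge0r. Qed.

Lemma inversionsE S T : inversions S T = (\sum_(p in S) \sum_(q in T) (q < p))%N.
Proof.
rewrite /inversions -sum1_card pair_big_dep /= [RHS]big_mkcond [LHS]big_mkcond.
by apply: eq_bigr => -[p q] _; rewrite inE /=; case: (p \in S); case: (q \in T); case: ltnP.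
Qed.

(** Every pair of distinct indices is an inversion in exactly one of the two
    orders. *)
Lemma inversions_swap S T : [disjoint S & T] ->
  (inversions S T + inversions T S = #|S| * #|T|)%N.
Proof.
move=> ST; rewrite !inversionsE [in X in (_ + X)%N]exchange_big /= -big_split /=.
rewrite -sum_nat_const; apply: eq_bigr => p pS; rewrite -big_split /= -sum1_card.
apply: eq_bigr => q qT; have : p != q.
  by apply: contraTneq pS => ->; rewrite (disjointFl ST).
by rewrite -val_eqE /=; case: ltngtP.
Qed.

Lemma wedge_monomial_swap S T : 'e^S ∧ 'e^T = (-1) ^+ (#|S| * #|T|) *: ('e^T ∧ 'e^S).
Proof.
rewrite !wedge_monomial disjoint_sym setUC; case: ifP => [TS|]; last by rewrite scaler0.
rewrite -inversions_swap 1?disjoint_sym // scalerA exprD -mulrA -exprD -signr_odd.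
by rewrite addnn signr_odd -mul2n exprM sqrrN !expr1n mulr1.
Qed.

Definition homogeneous r a := forall S, #|S| != r -> a S = 0.

Lemma homogeneous_monomial S : homogeneous #|S| 'e^S.
Proof. by move=> T; rewrite ffunE; have [->|] := eqVneq T S; rewrite ?eqxx. Qed.

Lemma homogeneousZ r (k : K) a : homogeneous r a -> homogeneous r (k *: a).
Proof. by move=> ha S /ha; rewrite ffunE => ->; rewrite scaler0. Qed.

Lemma homogeneousN r a : homogeneous r a -> homogeneous r (- a).
Proof. by move=> ha S /ha; rewrite ffunE => ->; rewrite oppr0. Qed.

Lemma homogeneousD r a b : homogeneous r a -> homogeneous r b -> homogeneous r (a + b).
Proof. by move=> ha hb S Sr; rewrite ffunE ha ?hb ?addr0. Qed.

Lemma homogeneous_sum r I (s : seq I) (P : pred I) (F : I -> form K) :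
  (forall i, P i -> homogeneous r (F i)) -> homogeneous r (\sum_(i <- s | P i) F i).
Proof.
move=> hF; apply: (big_ind (homogeneous r)) => //; last exact: homogeneousD.
by move=> S; rewrite ffunE.
Qed.

Lemma homogeneous_wedge r s a b :
  homogeneous r a -> homogeneous s b -> homogeneous (r + s) (a ∧ b).
Proof.
move=> ha hb U Urs; rewrite ffunE big1 // => S SU.
have [Sr|/ha->] := eqVneq #|S| r; last by rewrite mul0r mulr0.
rewrite hb ?mulr0 //; apply: contra Urs => /eqP <-.
by rewrite -Sr -(cardsID S U) (setIidPr SU).
Qed.

Lemma wedge1l a : 'e^set0 ∧ a = a.
Proof.
apply/ffunP => U; rewrite ffunE (bigD1 set0) ?sub0set //= big1.
  by rewrite addr0 ffunE eqxx mul1r setD0 inversionsE big_set0 expr0 mul1r.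
by move=> S /andP[_ /negPf S0]; rewrite ffunE S0 mul0r mulr0.
Qed.

Lemma wedge1r a : a ∧ 'e^set0 = a.
Proof.
apply/ffunP => U; rewrite ffunE (bigD1 U) //= big1 => [|S /andP[SU SnU]].
  rewrite addr0 ffunE setDv eqxx mulr1 inversionsE.
  by rewrite big1 ?expr0 ?mul1r // => p _; rewrite big_set0.
rewrite ffunE setD_eq0; have /negPf -> : ~~ (U \subset S).
  by apply: contra SnU => US; rewrite eqEsubset SU.
by rewrite !mulr0.
Qed.

End Exterior.

(** * The differential of the semidirect product *)

Section Differential.
Import mathcomp.boot.finset.
Variables (K : comNzRingType) (A : 'M[K]_5).
Implicit Types (a b c : form K) (S T U : {set 'I_6}).
Local Notation "''e^' S" := (monomial K S) (at level 8, S at level 2).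

(** The matrix of [ad e_0] on the whole Lie algebra: since the ideal is
    abelian, it determines the bracket. *)
Definition ad0 : 'M[K]_6 := @block_mx K 1 5 1 5 0 0 0 A.

Lemma ad0_0r i : ad0 i 0 = 0.
Proof.
by rewrite /ad0 mxE; case: splitP => i' _; rewrite mxE; case: splitP => j' // _;
  rewrite mxE.
Qed.

Lemma ad0_0l i : ad0 0 i = 0.
Proof.
by rewrite /ad0 mxE; case: splitP => i' // _; rewrite mxE; case: splitP => j' _;
  rewrite mxE.
Qed.

Lemma ad0_rshift (i j : 'I_5) : ad0 (rshift 1 i) (rshift 1 j) = A i j.
Proof. exact: block_mxEdr. Qed.

(** This is [d e^p = - e^0 /\ A^T e^p]: the only brackets of basis vectors that
    survive are those with [e_0], and they are the columns of [ad0]. *)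
Lemma dcovecE p : dcovec A p = \sum_m - ad0 p m *: 'e^[set 0; m].
Proof.
have e0_bvec (i : 'I_6) : i != 0 -> e0coord (bvec K i) = 0.
  by move=> i0; rewrite /e0coord mxE eq_sym (negPf i0).
have hpart_bvec (j : 'I_5) : hpart (bvec K (rshift 1 j)) = delta_mx j 0.
  by apply/colP => k; rewrite !mxE -!val_eqE /= eqn_add2l.
have bracket0 (j : 'I_5) : bracket A (bvec K 0) (bvec K (rshift 1 j)) p 0 = ad0 p (rshift
  1 j).
  rewrite /bracket /e0coord hpart_bvec [bvec _ _ _ _]mxE eqxx scale1r [bvec _ _ _ _]mxE /=.
  rewrite scale0r subr0 -colE; case: (@split_ordP 1 5 p) => k ->.
    rewrite (@col_mxEu K 1 5) mxE (_ : lshift 5 k = 0) ?ad0_0l //.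
    by apply: val_inj; rewrite /= ord1.
  by rewrite (@col_mxEd K 1 5) ad0_rshift mxE.
rewrite /dcovec big_ord_recl [X in _ + X]big1 ?addr0 => [|i _]; last first.
  rewrite big1 // => j ij.
  rewrite /bracket !e0_bvec //; last by apply: contraTneq ij => ->.
  by rewrite !scale0r subrr (@col_mx0 K 1 5) mxE oppr0 scale0r.
rewrite [LHS](@big_split_ord _ _ _ 1 5) [RHS](@big_split_ord _ _ _ 1 5) /= !big_ord1.
rewrite (_ : lshift 5 ord0 = 0); last exact: val_inj.
rewrite ad0_0r oppr0 scale0r big_pred0 => [|i]; last by rewrite ord1.
by rewrite !add0r; apply: eq_bigr => j _; rewrite -bracket0.
Qed.

(** The summand of the Leibniz rule in which [e^k] is differentiated in place,
    without its sign. *)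
Definition dfactor S (k : 'I_6) : form K :=
  'e^[set i in S | (i < k)%N] ∧ dcovec A k ∧ 'e^[set i in S | (k < i)%N].

Lemma dform_monomial S :
  dform A 'e^S = \sum_(k in S) (-1) ^+ #|[set i in S | (i < k)%N]| *: dfactor S k.
Proof.
rewrite /dform (bigD1 S) //= [X in _ + X]big1 => [|T /negPf TS];
  last by rewrite ffunE TS scale0r.
by rewrite addr0 ffunE eqxx scale1r.
Qed.

Lemma dformE a : dform A a = \sum_S a S *: dform A 'e^S.
Proof. by apply: eq_bigr => S _; rewrite dform_monomial. Qed.

Lemma dformD a b : dform A (a + b) = dform A a + dform A b.
Proof. by rewrite -big_split; apply: eq_bigr => S _; rewrite ffunE scalerDl. Qed.

Lemma dformZ (k : K) a : dform A (k *: a) = k *: dform A a.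
Proof. by rewrite scaler_sumr; apply: eq_bigr => S _; rewrite ffunE scalerA. Qed.

Lemma dform0 : dform A 0 = 0.
Proof. by rewrite -(scale0r (0 : form K)) dformZ !scale0r. Qed.

Lemma dform_sum I (r : seq I) (P : pred I) (F : I -> form K) :
  dform A (\sum_(i <- r | P i) F i) = \sum_(i <- r | P i) dform A (F i).
Proof. exact: (big_morph _ dformD dform0). Qed.

Lemma homogeneous_dcovec k : homogeneous 2 (dcovec A k).
Proof.
apply: homogeneous_sum => i _; apply: homogeneous_sum => j ij; apply: homogeneousZ.
have := @homogeneous_monomial K [set i; j]; rewrite cards2.
by have /negPf -> : i != j by apply: contraTneq ij => ->; rewrite ltnn.
Qed.

Lemma homogeneous_dform_monomial S : homogeneous #|S|.+1 (dform A 'e^S).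
Proof.
rewrite dform_monomial; apply: homogeneous_sum => k kS; apply: homogeneousZ.
have -> : (#|S|.+1 = #|[set i in S | (i < k)%N]| + 2 + #|[set i in S | (k < i)%N]|)%N.
  rewrite (cardsD1 k) kS -(cardsID [set i : 'I_6 | (i < k)%N] (S :\ k)).
  rewrite addnAC addn2 add1n; congr (_ + _).+2; apply: eq_card => i; rewrite !inE -val_eqE.
    by case: (i \in S); rewrite ?andbF ?andbT //=; case: ltngtP.
  by case: (i \in S); rewrite ?andbF ?andbT //=; case: ltngtP.
apply: homogeneous_wedge; last exact: homogeneous_monomial.
by apply: homogeneous_wedge; [exact: homogeneous_monomial | exact: homogeneous_dcovec].
Qed.

(** The differential raises the degree by one, so the degree [r.+1] part of
    [d a] sees only the degree [r] part of [a]. *)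
Lemma dform_degree r a b U : #|U| = r.+1 ->
  (forall S, #|S| = r -> a S = b S) -> dform A a U = dform A b U.
Proof.
move=> Ur ab; rewrite dformE [in RHS]dformE !sum_ffunE; apply: eq_bigr => S _.
rewrite !ffunE; have [/ab ->//|Sr] := eqVneq #|S| r.
by rewrite homogeneous_dform_monomial ?scaler0 // Ur eqSS eq_sym.
Qed.

(** Every [d e^k] is a multiple of [e^0], hence is killed by a factor [e^0];
    and [e^0] itself is closed. *)
Lemma dform_monomial_0 S : 0 \in S -> dform A 'e^S = 0.
Proof.
move=> S0; rewrite dform_monomial big1 // => k kS; rewrite /dfactor dcovecE.
rewrite wedge_sumr wedge_suml big1 ?scaler0 // => m _.
have [->|k0] := eqVneq k 0; first by rewrite ad0_0l oppr0 scale0r wedge0r wedge0l.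
rewrite wedgeZr wedge_monomial ifF ?scaler0 ?wedge0l //.
apply/negbTE/pred0Pn; exists 0; rewrite /= !inE eqxx S0 /= lt0n.
by rewrite -(inj_eq val_inj) in k0; rewrite k0.
Qed.

(** When the covectors [e^k], [k \in S], span a subspace invariant under the
    transpose of [ad e_0], their product [e^S] is a volume form of that
    subspace, and a derivation multiplies a volume form by a trace. *)
Lemma dform_invariant_monomial S : 0 \notin S ->
  (forall k m, k \in S -> m \notin S -> ad0 k m = 0) ->
  dform A 'e^S = - (\sum_(k in S) ad0 k k) *: 'e^(0 |: S).
Proof.
move=> S0 AS; rewrite dform_monomial -sumrN scaler_suml; apply: eq_bigr => k kS.
rewrite /dfactor dcovecE wedge_sumr wedge_suml (bigD1 k) //= big1 ?addr0 => [|m mk].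
  set L := [set i in S | _]; set G := [set i in S | _].
  have k0 : 0 != k by apply: contraNneq S0 => ->.
  have LP p : p \in L -> (0 < p < k)%N.
    rewrite inE => /andP[pS ->]; rewrite andbT lt0n.
    by apply: contraNneq S0 => p0; rewrite (_ : 0 = p) //; apply: val_inj.
  have GP q : q \in G -> (k < q)%N by rewrite inE => /andP[].
  rewrite wedgeZr wedge_monomial ifT; last first.
    apply/pred0P => x /=; rewrite [_ \in [set _; _]]inE !in_set1; apply/negP.
    by move=> /andP[/LP/andP[x0 xk] /orP[/eqP xE|/eqP xE]];
      rewrite xE ?ltnn in x0 xk.
  rewrite !wedgeZl wedge_monomial ifT; last first.
    apply/pred0P => x /=; rewrite !in_setU !in_set1; apply/negP.
    move=> /andP[+ /GP kx] => /orP[/LP/andP[_ /(ltn_trans kx)]|/orP[] /eqP xE].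
    - by rewrite ltnn.
    - by rewrite xE in kx.
    - by rewrite xE ltnn in kx.
  have -> : inversions L [set 0; k] = #|L|.
    rewrite inversionsE -sum1_card; apply: eq_bigr => p /LP/andP[p0 pk].
    by rewrite big_setU1 ?in_set1 //= big_set1 p0 ltnNge (ltnW pk).
  have -> : inversions (L :|: [set 0; k]) G = 0%N.
    rewrite inversionsE big1 // => p pL; rewrite big1 // => q /GP kq.
    apply/eqP; rewrite eqb0 -leqNgt (leq_trans _ (ltnW kq)) //.
    by move: pL; rewrite !in_setU !in_set1 => /orP[/LP/andP[_ /ltnW]|/orP[] /eqP ->].
  have -> : L :|: [set 0; k] :|: G = 0 |: S.
    apply/setP => x; rewrite !inE -!val_eqE /=; have [->|x0] := eqVneq (val x) 0%N.
      by rewrite !(orbT, orTb).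
    have := kS; case: (ltngtP x k) => [xk|kx|/val_inj ->];
      by rewrite ?(orbF, orbT, andbT, andbF) //= => ->.
  rewrite expr0 scale1r !scalerA; congr (_ *: _).
  by rewrite mulrCA -exprD addnn -mul2n exprM sqrrN !expr1n mulr1.
(* an off-diagonal term repeats a factor of [e^S] *)
have [mS|mS] := boolP (m \in S); last by rewrite AS // oppr0 scale0r wedge0r wedge0l.
have [mltk|kltm|/val_inj mk'] := ltngtP m k; last by rewrite mk' eqxx in mk.
  rewrite wedgeZr wedge_monomial ifF ?scaler0 ?wedge0l //.
  by apply/negbTE/pred0Pn; exists m; rewrite /= !inE eqxx mS mltk orbT.
rewrite wedgeZr wedge_monomial; case: ifP => _; last by rewrite scaler0 wedge0l.
rewrite !wedgeZl wedge_monomial ifF ?scaler0 //.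
by apply/negbTE/pred0Pn; exists m; rewrite /= !inE eqxx mS kltm !orbT.
Qed.
End Differential.

(** * The differential in degrees one and two *)

Section LowDegree.
Import mathcomp.boot.finset.
Variables (K : comNzRingType) (A : 'M[K]_5).
Implicit Types (a b c : form K) (S T U : {set 'I_6}).
Local Notation "''e^' S" := (monomial K S) (at level 8, S at level 2).

Let neqE (T : eqType) (x y : T) : x != y -> ((x == y) = false) * ((y == x) = false).
Proof. by move=> /negPf xy; rewrite [y == x]eq_sym !xy. Qed.

Lemma dform_covector k : dform A 'e^[set k] = dcovec A k.
Proof.
rewrite dform_monomial big_set1 /dfactor.
have E (P : pred 'I_6) : ~~ P k -> [set i in [set k] | P i] = set0.
  move=> Pk; apply/setP => i; rewrite !inE; apply/negP => /andP[/eqP -> Pk'].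
  by rewrite Pk' in Pk.
by rewrite !E ?ltnn // cards0 expr0 scale1r wedge1l wedge1r.
Qed.

Lemma dform_bivector (k l : 'I_6) : (k < l)%N ->
  dform A 'e^[set k; l] = dcovec A k ∧ 'e^[set l] - 'e^[set k] ∧ dcovec A l.
Proof.
move=> kl; have kl' : k != l by apply: contraTneq kl => ->; rewrite ltnn.
have E (P : pred 'I_6) : [set i in [set k; l] | P i] =
    (if P k then [set k] else set0) :|: (if P l then [set l] else set0).
  apply/setP => i; rewrite !inE.
  have [->|ik] := eqVneq i k; first by case: (P k); case: (P l);
    rewrite !inE ?eqxx ?(negPf kl').
  have [->|il] := eqVneq i l; first by case: (P k); case: (P l);
    rewrite !inE ?eqxx ?orbT // eq_sym (negPf kl').
  by case: (P k); case: (P l); rewrite !inE ?(negPf ik) ?(negPf il).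
rewrite dform_monomial big_setU1 ?in_set1 //= big_set1 /dfactor !E /= !ltnn kl.
rewrite ltnNge (ltnW kl) /= !(set0U, setU0) cards0 cards1 expr0 expr1 scale1r scaleN1r.
by rewrite wedge1l wedge1r.
Qed.

Lemma dform1E a j : j != 0 ->
  dform A a [set 0; j] = - \sum_k ad0 A k j * a [set k].
Proof.
move=> j0; rewrite (@dform_degree _ _ 1 _ (\sum_k a [set k] *: 'e^[set k])).
- rewrite dform_sum sum_ffunE -sumrN; apply: eq_bigr => k _.
  rewrite dformZ dform_covector dcovecE ffunE sum_ffunE (bigD1 j) //= big1.
    by rewrite addr0 !ffunE eqxx [_ *: 1]mulr1 [_ *: _]mulrC mulNr.
  move=> m mj; rewrite !ffunE; case: eqP => [/setP E|]; last by rewrite scaler0.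
  move: (E j) (E m); rewrite !inE !eqxx !orbT (negPf j0) (negPf mj) orbF /=.
  by rewrite eq_sym (negPf mj).
- by rewrite cards2 eq_sym j0.
- move=> S /eqP/cards1P[k ->]; rewrite sum_ffunE (bigD1 k) //= big1.
    by rewrite addr0 !ffunE eqxx [RHS]mulr1.
  move=> m mk; rewrite !ffunE; case: eqP => [/set1_inj E|]; last by rewrite scaler0.
  by rewrite E eqxx in mk.
Qed.

(** The skew-symmetric matrix of the degree two part of a form. *)
Definition coef2 a (k l : 'I_6) : K :=
  a [set k; l] *+ (k < l)%N - a [set k; l] *+ (l < k)%N.

Lemma wedge_0ml (i j m l : 'I_6) : (0 < i < j)%N ->
  ('e^[set 0; m] ∧ 'e^[set l]) [set 0; i; j] =
   ((m == i) && (l == j))%:R - ((m == j) && (l == i))%:R.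
Proof.
move=> /andP[i0 ij].
have i0' : 0 != i by rewrite -val_eqE /= eq_sym -lt0n.
have j0' : 0 != j by rewrite -val_eqE /= eq_sym -lt0n (ltn_trans i0).
have ij' : i != j by rewrite -val_eqE /= neq_ltn ij.
have inv (p q : 'I_6) : 0 != p -> inversions [set 0; p] [set q] = (q < p)%N.
  by move=> p0; rewrite inversionsE big_setU1 ?in_set1 //= !big_set1.
rewrite wedge_monomial; case: ifP => [D|D].
  have l0 : l != 0.
    by apply: contraTneq D => ->; apply/pred0Pn; exists 0; rewrite /= !inE.
  have lm : l != m.
    by apply: contraTneq D => ->; apply/pred0Pn; exists m; rewrite /= !inE eqxx orbT.
  rewrite !ffunE.
  have [->|mi] := eqVneq m i; have [->|lj] := eqVneq l j => /=.
  - by rewrite eqxx inv // ltnNge (ltnW ij) expr0 ?(neqE ij') scale1r subr0.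
  - rewrite ?(neqE ij') subr0; case: eqP => [/setP/(_ j)|]; last by rewrite scaler0.
    by rewrite !inE eqxx !orbT ?(neqE j0') ?(neqE ij') ?(neqE lj).
  - rewrite ?(neqE ij') andbF subr0.
    case: eqP => [/setP/(_ i)|]; last by rewrite scaler0.
    by rewrite !inE eqxx !orbT ?(neqE i0') ?(neqE mi) ?(neqE ij').
  have [->|mj] := eqVneq m j; have [->|li] := eqVneq l i => /=.
  - by rewrite inv // ij expr1 setUAC eqxx sub0r [_ *: _]mulr1.
  - rewrite subr0; case: eqP => [/setP/(_ i)|]; last by rewrite scaler0.
    by rewrite !inE eqxx !orbT ?(neqE i0') ?(neqE ij') ?(neqE li).
  - rewrite subr0; case: eqP => [/setP/(_ j)|]; last by rewrite scaler0.
    by rewrite !inE eqxx !orbT ?(neqE j0') ?(neqE mj) ?(neqE ij').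
  rewrite subr0; case: eqP => [/setP/(_ i)|]; last by rewrite scaler0.
  by rewrite !inE eqxx !orbT ?(neqE i0') ?(neqE mi) ?(neqE li).
have /orP[/eqP ->|/eqP ->] : (l == 0) || (l == m).
- apply: contraFT D; rewrite negb_or => /andP[l0 lm].
  by rewrite disjoint_sym disjoints1 !inE negb_or l0 lm.
- by rewrite ?(neqE i0') ?(neqE j0') !andbF ffunE subr0.
have [->|mi] := eqVneq m i; first by rewrite ?(neqE ij') ffunE subr0.
by rewrite andbF ffunE subr0.
Qed.

(** Summing a skew-symmetrized kernel over increasing pairs is summing the
    kernel against the skew-symmetric matrix of the form. *)
Lemma sum_coef2 a (g : 'I_6 -> 'I_6 -> K) :
  \sum_(k < 6) \sum_(l < 6 | (k < l)%N) a [set k; l] * (g k l - g l k) =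
  \sum_k \sum_l coef2 a k l * g k l.
Proof.
transitivity (\sum_(k < 6) \sum_(l < 6) (a [set k; l] *+ (k < l)%N) * g k l -
              \sum_(k < 6) \sum_(l < 6) (a [set k; l] *+ (k < l)%N) * g l k).
  rewrite -sumrB; apply: eq_bigr => k _; rewrite -sumrB big_mkcond.
  by apply: eq_bigr => l _; case: ifP => _; rewrite ?mulr0n ?mulr1n ?mul0r ?subr0 // mulrBr.
rewrite [X in _ - X]exchange_big -sumrB; apply: eq_bigr => k _ /=.
rewrite -sumrB; apply: eq_bigr => l _.
by rewrite /coef2 mulrBl [[set l; k]]setUC.
Qed.

(** On a two-form with skew matrix [W], the contraction of [d] with [e_0] is the
    infinitesimal action [- (D^T W + W D)] of [D = ad e_0]. *)
Lemma dform2E a (i j : 'I_6) : (0 < i < j)%N ->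
  dform A a [set 0; i; j] =
  - \sum_k (ad0 A k i * coef2 a k j + ad0 A k j * coef2 a i k).
Proof.
move=> ij; have [i0 iltj] := andP ij.
have i0' : 0 != i by rewrite -val_eqE /= eq_sym -lt0n.
have j0' : 0 != j by rewrite -val_eqE /= eq_sym -lt0n (ltn_trans i0).
have ij' : i != j by rewrite -val_eqE /= neq_ltn iltj.
(* [b] is the part of degree two of [a] *)
pose b := \sum_(k < 6) \sum_(l < 6 | (k < l)%N) a [set k; l] *: 'e^[set k; l].
rewrite (@dform_degree _ _ 2 _ b).
- have pick (f : 'I_6 -> K) p (q : bool) : \sum_m f m * ((m == p) && q)%:R = f p * q%:R.
    rewrite (bigD1 p) //= eqxx big1 ?addr0 // => m /negPf ->.
    by rewrite mulr0.
  have pick1 (f : 'I_6 -> K) p : \sum_m f m * (m == p)%:R = f p.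
    by have := pick f p true; under eq_bigr do rewrite andbT; rewrite mulr1.
  pose g (k l : 'I_6) : K := - (ad0 A k i * (l == j)%:R - ad0 A k j * (l == i)%:R).
  have dE (k l : 'I_6) : (dcovec A k ∧ 'e^[set l]) [set 0; i; j] = g k l.
    rewrite dcovecE wedge_suml sum_ffunE /g.
    under eq_bigr do rewrite wedgeZl ffunE wedge_0ml //.
    under eq_bigr do rewrite [_ *: _]mulrBr.
    by rewrite sumrB !pick; ring.
  transitivity (\sum_(k < 6) \sum_(l < 6 | (k < l)%N) a [set k; l] * (g k l - g l k)).
    rewrite dform_sum sum_ffunE; apply: eq_bigr => k _.
    rewrite dform_sum sum_ffunE; apply: eq_bigr => l kl.
    rewrite dformZ dform_bivector // formZ formD formN.
    rewrite dE -(dE l k); congr (_ * (_ - _)).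
    rewrite dcovecE wedge_sumr wedge_suml !sum_ffunE; apply: eq_bigr => m _.
    have [->|m0] := eqVneq m 0; first by rewrite ad0_0r oppr0 !scale0r wedge0l wedge0r.
    rewrite wedgeZr wedgeZl wedge_monomial_swap cards1 cards2 eq_sym m0.
    by rewrite mul1n expr2 mulrNN mulr1 scale1r.
  rewrite sum_coef2 -sumrN.
  under eq_bigr => k _ do under eq_bigr => l _ do
    rewrite /g mulrN mulrBr [X in - (X - _)]mulrCA [X in - (_ - X)]mulrCA.
  transitivity (\sum_(k < 6) (ad0 A k j * coef2 a k i - ad0 A k i * coef2 a k j)).
    apply: eq_bigr => k _.
    under eq_bigr do rewrite opprB.
    by rewrite sumrB -!mulr_sumr !pick1.
  apply: eq_bigr => k _; rewrite (_ : coef2 a i k = - coef2 a k i); first by ring.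
  by rewrite /coef2 setUC opprB.
- by rewrite setUC cardsU1 cards2 !inE ?(neqE i0') ?(neqE j0') ?(neqE ij').
move=> S /eqP/cards2P[x [y [xy ->]]].
wlog xley : x y xy / (x < y)%N.
  move=> H; have := xy; rewrite -val_eqE /= neq_ltn => /orP[] lt; first exact: H.
  by rewrite setUC; apply: H; rewrite // eq_sym.
rewrite /b sum_ffunE (bigD1 x) //= sum_ffunE (bigD1 y) //= !ffunE eqxx.
rewrite [X in _ + X + _]big1 => [|l /andP[xl ly]]; last first.
  rewrite !ffunE; case: eqP => [/setP/(_ l)|]; last by rewrite scaler0.
  rewrite !inE eqxx orbT ?(neqE ly) orbF => /eqP E; move: xl; rewrite E ltnn //.
rewrite big1 => [|k kx]; first by rewrite !addr0 [_ *: 1]mulr1.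
rewrite sum_ffunE big1 // => l kl; rewrite !ffunE.
case: eqP => [E|]; last by rewrite scaler0.
have : k \in [set x; y] by rewrite E !inE eqxx.
rewrite !inE (negPf kx) /= => /eqP ky; have : l \in [set x; y] by rewrite E !inE eqxx orbT.
by rewrite !inE => /orP[] /eqP le; move: kl; rewrite ky le ?ltnn // ltnNge (ltnW xley).
Qed.

End LowDegree.

(** * Lowest-degree part of a pure spinor *)

Section Spinor.
Import mathcomp.boot.finset.
Variable (K : fieldType).
Implicit Types (a b c : form K) (S T U : {set 'I_6}).
Local Notation "''e^' S" := (monomial K S) (at level 8, S at level 2).

Lemma wedge_set0 a b : (a ∧ b) set0 = a set0 * b set0.
Proof.
rewrite ffunE (bigD1 set0) //= big1 => [|S /andP[]]; last first.
  by rewrite subset0 => ->.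
by rewrite addr0 setDv inversionsE big_set0 expr0 mul1r.
Qed.

Lemma expform_set0 a : a set0 = 0 -> expform a set0 = 1.
Proof.
move=> a0; rewrite /expform sum_ffunE big_ord_recl big1 => [|k _].
  by rewrite addr0 /= ffunE ffunE eqxx invr1 [LHS]mulr1.
by rewrite formZ /= wedge_set0 a0 mul0r mulr0.
Qed.

(** [exp a = 1 + (terms of positive degree)], so wedging with [exp a] does not
    change the component of lowest degree. *)
Lemma expform_wedge_lowest r a b S : a set0 = 0 -> homogeneous r b -> #|S| = r ->
  (expform a ∧ b) S = b S.
Proof.
move=> a0 hb Sr; rewrite ffunE (bigD1 set0) ?sub0set //= big1 => [|T /andP[TS T0]].
  by rewrite addr0 setD0 expform_set0 // inversionsE big_set0 expr0 !mul1r.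
rewrite hb ?mulr0 // -Sr; apply: contra T0 => /eqP E; rewrite -cards_eq0.
by move: (cardsID T S); rewrite (setIidPr TS) E => /(canRL (addnK _)); rewrite subnn => ->.
Qed.

Lemma wedge_iter0 S (k : K) n : S != set0 ->
  iter n.+2 (wedge (k *: 'e^S)) ('e^set0) = 0.
Proof.
move=> S0; elim: n => [|n IHn]; last by rewrite iterS IHn wedge0r.
rewrite /= wedge1r wedgeZl wedgeZr wedge_monomial ifF ?scaler0 //.
by apply: contraNF S0; rewrite -setI_eq0 setIid.
Qed.

Lemma expform_monomial S (k : K) : S != set0 -> expform (k *: 'e^S) = 'e^set0 + k *: 'e^S.
Proof.
move=> S0; rewrite /expform 2!big_ord_recl big1 => [|i _]; last first.
  by rewrite -[iter _ _ _]/(iter i.+2 _ _) wedge_iter0 // scaler0.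
by rewrite addr0 /= wedge1r fact0 !invr1 !scale1r.
Qed.

Lemma wedge_covectors a b (k l : 'I_6) : homogeneous 1 a -> homogeneous 1 b -> (k < l)%N ->
  (a ∧ b) [set k; l] = a [set k] * b [set l] - a [set l] * b [set k].
Proof.
move=> ha hb kl; have kl' : k != l by rewrite -val_eqE /= neq_ltn kl.
have lk' : l != k by rewrite eq_sym.
have k_l : [set l] != [set k] :> {set 'I_6} by rewrite (inj_eq set1_inj).
rewrite ffunE (bigD1 [set k]) ?sub1set ?inE ?eqxx //= (bigD1 [set l]) /=; last first.
  by rewrite sub1set !inE eqxx orbT.
rewrite big1 ?addr0 => [|S /andP[/andP[SU Sk] Sl]]; last first.
  have [/cards1P[x Sx]|/ha ->] := boolP (#|S| == 1)%N; last by rewrite mul0r mulr0.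
  move: SU Sk Sl; rewrite Sx sub1set !inE !(inj_eq set1_inj).
  by case: eqP => // _ /= ->.
have -> : [set k; l] :\: [set k] = [set l].
  by rewrite setDUl setDv set0U; apply/setDidPl; rewrite disjoints1 inE.
have -> : [set k; l] :\: [set l] = [set k].
  by rewrite setDUl setDv setU0; apply/setDidPl; rewrite disjoints1 inE.
by rewrite !inversionsE !big_set1 kl ltnNge (ltnW kl) expr0 expr1 mul1r mulN1r.
Qed.

Lemma coef2_wedge a b (k l : 'I_6) : homogeneous 1 a -> homogeneous 1 b ->
  coef2 (a ∧ b) k l = a [set k] * b [set l] - a [set l] * b [set k].
Proof.
move=> ha hb; rewrite /coef2; case: (ltngtP k l) => [kl|lk|/val_inj ->].
- by rewrite mulr1n mulr0n subr0 wedge_covectors.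
- by rewrite mulr1n mulr0n sub0r setUC wedge_covectors // opprB.
- by rewrite !mulr0n !subrr.
Qed.

(** The part of degree two of a closed [exp a /\ b], with [b] a covector, is
    [d b]. *)
Lemma closed_covector (A : 'M[K]_5) a b j :
  a set0 = 0 -> homogeneous 1 b -> dform A (expform a ∧ b) = 0 -> j != 0 ->
  \sum_k ad0 A k j * b [set k] = 0.
Proof.
move=> a0 hb cl j0; apply/eqP; rewrite -oppr_eq0 -dform1E //.
rewrite (@dform_degree _ _ 1 _ (expform a ∧ b)) ?cl ?ffunE //.
  by rewrite cards2 eq_sym j0.
by move=> S S1; rewrite (expform_wedge_lowest a0 hb).
Qed.

(** Likewise for a decomposable [b /\ c]: the degree three part is
    [d (b /\ c)], read off with [dform2E]. *)
Lemma closed_bivector (A : 'M[K]_5) a b c (i j : 'I_6) :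
  a set0 = 0 -> homogeneous 1 b -> homogeneous 1 c ->
  dform A (expform a ∧ (b ∧ c)) = 0 -> (0 < i < j)%N ->
  \sum_k (ad0 A k i * (b [set k] * c [set j] - b [set j] * c [set k])
        + ad0 A k j * (b [set i] * c [set k] - b [set k] * c [set i])) = 0.
Proof.
move=> a0 hb hc cl ij; have hbc := homogeneous_wedge hb hc.
under eq_bigr do rewrite -!coef2_wedge //.
apply/eqP; rewrite -oppr_eq0 -dform2E //.
rewrite (@dform_degree _ _ 2 _ (expform a ∧ (b ∧ c))) ?cl ?ffunE //.
  by move: ij => /andP[i0 ij]; rewrite setUC cardsU1 cards2 !inE -!val_eqE /=;
    rewrite (gtn_eqF ij) (gtn_eqF (ltn_trans i0 ij)) (ltn_eqF i0).
by move=> S S2; rewrite (expform_wedge_lowest a0 hbc).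
Qed.

End Spinor.

(** * The algebra generated by the exceptional matrix *)

Section Blk.
Variable K : comNzRingType.

(** The exceptional matrix, its powers and its exponential all lie in this
    three-dimensional commutative algebra: a Jordan-type 2-block [a + b N] next
    to a scalar 3-block [c]. *)
Definition blk (a b c : K) : 'M[K]_5 :=
  @block_mx K 2 3 2 3 (a%:M + b *: delta_mx 0 1) 0 0 c%:M.

Lemma blk1E : blk 1 0 1 = 1%:M.
Proof. by rewrite /blk scale0r addr0 -(@scalar_mx_block K 2 3). Qed.

Lemma blkM a b c a' b' c' :
  blk a b c *m blk a' b' c' = blk (a * a') (a * b' + a' * b) (c * c').
Proof.
rewrite /blk (@mulmx_block K 2 3 2 3 2 3) !(mulmx0, mul0mx, addr0, add0r).
rewrite -scalar_mxM; congr (@block_mx K 2 3 2 3 _ 0 0 _).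
rewrite mulmxDl !mulmxDr -scalar_mxM !mul_scalar_mx -!scalemxAl -?scalemxAr.
by rewrite mul_delta_mx_0 // !scaler0 addr0 mul_mx_scalar !scalerA -addrA -scalerDl [b *
  _]mulrC.
Qed.

Lemma blkD a b c a' b' c' :
  blk a b c + blk a' b' c' = blk (a + a') (b + b') (c + c').
Proof.
rewrite /blk (@add_block_mx K 2 3 2 3) !addr0 !raddfD; congr (@block_mx K 2 3 2 3 _ 0 0 _).
by rewrite ?raddfD scalerDl addrACA.
Qed.

Lemma blkZ k a b c : k *: blk a b c = blk (k * a) (k * b) (k * c).
Proof.
rewrite /blk (@scale_block_mx K 2 3 2 3) !scaler0 !scale_scalar_mx.
by rewrite scalerDr scale_scalar_mx scalerA.
Qed.

Lemma blkX a b c n :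
  blk a b c ^+ n = blk (a ^+ n) (b * (a ^+ n.-1 *+ n)) (c ^+ n).
Proof.
elim: n => [|n IHn]; first by rewrite !expr0 mulr0n mulr0 blk1E.
rewrite exprS IHn -[_ * _]/(_ *m _) blkM -!exprS; congr blk.
case: n {IHn} => [|n] /=; first by rewrite mulr0n mulr1n !mulr0 mulr1 add0r mul1r.
by rewrite [a * (b * _)]mulrCA [a * (_ *+ _)]mulrnAr -exprS [in RHS]mulrS mulrDr addrC [_
  * b]mulrC.
Qed.

Lemma det_blk a b c : \det (blk a b c) = a ^+ 2 * c ^+ 3.
Proof.
rewrite /blk (@det_ublock K 2 3) det_scalar (expand_det_row _ 0) big_ord_recl.
rewrite big_ord1 /cofactor !det_mx11 !mxE /=.
rewrite !(mulr0n, mulr1n, mulr0, addr0, mulr1, expr0, mul1r, mul0r).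
by [].
Qed.

Lemma jordan_blk (l m : K) :
  jordan 2 l ⊕ blk1 m ⊕ blk1 m ⊕ blk1 m = blk l 1 m.
Proof.
rewrite /blk /dsum; congr (@block_mx K 2 3 2 3 _ 0 0 _).
  apply/matrixP => i j; rewrite !mxE mul1r; congr (_ + _).
  by case: i j => [[|[|i]] Hi] [[|[|j]] Hj].
by rewrite /blk1 -!scalar_mx_block.
Qed.
End Blk.

Lemma blkE (K : comNzRingType) (a b c : K) (i j : 'I_5) :
  blk a b c i j = (if (i < 2)%N then a else c) *+ (i == j) + b *+ ((i == 0) && (j == 1)).
Proof.
rewrite /blk mxE -!val_eqE.
case: splitP => i' /= ->; rewrite mxE; case: splitP => j' /= ->; rewrite !mxE.
- by rewrite ltn_ord mulr_natr -!val_eqE.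
- case: i' j' => [[|[|i']] Hi] [j' Hj] //=; by rewrite mulr0n addr0.
- by case: j' => [[|[|j']] Hj] //=; rewrite mulr0n addr0.
- by rewrite mulr0n addr0 eqn_add2l -val_eqE.
Qed.

Lemma blk_mulE (K : comNzRingType) (a b c : K) (w : 'cV[K]_5) :
  blk a b c *m w = \col_i ((if (i < 2)%N then a else c) * w i 0 + (b * w 1 0) *+ (i == 0)).
Proof.
apply/colP => i; rewrite !mxE; under eq_bigr do rewrite blkE mulrDl.
rewrite big_split /=; congr (_ + _).
  by rewrite (bigD1 i) //= eqxx big1 ?addr0 // => j /negPf; rewrite eq_sym => ->;
    rewrite mul0r.
rewrite (bigD1 1) //= andbT big1 ?addr0 ?mulrnAl // => j /negPf ->.
by rewrite andbF mul0r.
Qed.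

Lemma map_blk (K L : comNzRingType) (f : {rmorphism K -> L}) a b c :
  map_mx f (blk a b c) = blk (f a) (f b) (f c).
Proof.
by apply/matrixP => i j; rewrite mxE !blkE rmorphD !rmorphMn; case: ifP.
Qed.

(** A member of the algebra with [k != 0] and two distinct eigenvalues has a
    minimal polynomial of degree three, so its powers span the whole algebra. *)
Lemma blk_polynomial (K : fieldType) (mu k nu a b c : K) :
  k != 0 -> mu != nu -> exists p : {poly K}, blk a b c = horner_mx (blk mu k nu) p.
Proof.
move=> k0; rewrite eq_sym -subr_eq0 => d0.
(* Hermite interpolation: value [a] and slope [y] at [mu], value [c] at [nu] *)
have [y yE] : exists y, y * k = b by exists (b / k); rewrite divfK.
have [z zE] : exists z, z * (nu - mu) ^+ 2 = c - a - y * (nu - mu).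
  by exists ((c - a - y * (nu - mu)) / (nu - mu) ^+ 2); rewrite divfK ?expf_neq0.
exists (a%:P + y%:P * ('X - mu%:P) + z%:P * ('X - mu%:P) ^+ 2).
rewrite !(rmorphD, rmorphM, rmorphXn, rmorphN) /= !horner_mx_C !horner_mx_X.
have -> : blk mu k nu - mu%:M = blk 0 k (nu - mu).
  by rewrite -scalemx1 -blk1E -scaleNr blkZ blkD; congr blk; ring.
rewrite -![_ * _]/(_ *m _) !mul_scalar_mx -[a%:M]scalemx1 -blk1E.
rewrite !(blkM, blkZ, blkD); congr blk; [ring | by rewrite -yE; ring |].
by rewrite !(mulr0, mulr1, mul0r, addr0) -expr2 zE; ring.
Qed.

Lemma addmxE (V : nmodType) m n (A B : 'M[V]_(m, n)) i j :
  (A + B) i j = A i j + B i j.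
Proof. by rewrite mxE. Qed.

Lemma oppmxE (V : zmodType) m n (A : 'M[V]_(m, n)) i j : (- A) i j = - A i j.
Proof. by rewrite mxE. Qed.

Lemma col_mulmx (K : pzRingType) m n p (A : 'M[K]_(m, n)) (B : 'M[K]_(n, p)) i :
  col i (A *m B) = A *m col i B.
Proof. by rewrite !colE mulmxA. Qed.

Ltac mx_zmod := apply/matrixP => ? ?; rewrite !(addmxE, oppmxE); ring.

(** * Coordinates indexed by natural numbers *)

Section Coordinates.
Import mathcomp.boot.finset.
Variable K : comNzRingType.

(** Entries are recorded as functions on [nat], so that they compute on
    literals once the block structure has been read off. *)
Definition entries n (A : 'M[K]_n) (f : nat -> nat -> K) :=
  forall i j : 'I_n, A i j = f i j.

Definition block_entries m (f g : nat -> nat -> K) (i j : nat) : K :=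
  if (i < m)%N then if (j < m)%N then f i j else 0
  else if (j < m)%N then 0 else g (i - m)%N (j - m)%N.

Lemma entries_dsum m n (A : 'M[K]_m) (B : 'M[K]_n) f g :
  entries A f -> entries B g -> entries (A ⊕ B) (block_entries m f g).
Proof.
move=> Af Bg i j; rewrite /dsum /block_entries mxE.
by case: splitP => i' ei; rewrite mxE; case: splitP => j' ej;
  rewrite ?ei ?ej ?addKn ?mxE.
Qed.

Definition jordan_entries (t : K) (i j : nat) : K := t *+ (i == j) + (i.+1 == j)%:R.

Definition Cmx_entries (a b : K) (i j : nat) : K :=
  if i == j then a else if (i < j)%N then - b else b.

Lemma entries_jordan r t : entries (jordan r t) (jordan_entries t).
Proof. by move=> i j; rewrite mxE. Qed.

Lemma entries_Cmx a b : entries (Cmx a b) (Cmx_entries a b).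
Proof. by move=> i j; rewrite mxE. Qed.

Lemma entries_blk1 t : entries (blk1 t) (fun _ _ => t).
Proof. by move=> i j; rewrite mxE !ord1. Qed.

Definition blk_entries (a b c : K) (i j : nat) : K :=
  (if (i < 2)%N then a else c) *+ (i == j) + b *+ ((i == 0%N) && (j == 1%N)).

Lemma entries_blk a b c : entries (blk a b c) (blk_entries a b c).
Proof. by move=> i j; rewrite blkE. Qed.

Lemma ad0E (A : 'M[K]_5) f k m : entries A f ->
  ad0 A k m = if (0 < k)%N && (0 < m)%N then f k.-1 m.-1 else 0.
Proof.
move=> Af; case: (unliftP ord0 k) => [k' ->|->]; last by rewrite ad0_0l.
case: (unliftP ord0 m) => [m' ->|->]; last by rewrite ad0_0r andbF.
have E (i : 'I_5) : lift ord0 i = rshift 1 i by exact: val_inj.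
by rewrite /= !add0n !E ad0_rshift Af.
Qed.

Lemma sum_ad0 (A : 'M[K]_5) f j (F : 'I_6 -> K) : entries A f -> (j < 5)%N ->
  \sum_k ad0 A k (inord j.+1) * F k = \sum_(0 <= k < 5) f k j * F (inord k.+1).
Proof.
move=> Af j5; rewrite big_ord_recl ad0_0l mul0r add0r big_mkord.
apply: eq_bigr => k _; rewrite (ad0E _ _ Af) /= inordK //=.
by congr (_ * F _); apply: val_inj; rewrite /= inordK // ltnS.
Qed.

Definition covector (b : form K) (g : nat -> K) :=
  homogeneous 1 b /\ forall k, (k < 6)%N -> b [set inord k] = g k.

Lemma covector_e p : (p < 6)%N -> covector (\e_p) (fun k => (k == p)%:R).
Proof.
move=> p6; split=> [|k k6].
  by have := @homogeneous_monomial K [set inord p]; rewrite cards1.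
by rewrite ffunE (inj_eq set1_inj) -val_eqE /= !inordK.
Qed.

Lemma covectorZ (x : K) b g : covector b g -> covector (x *: b) (fun k => x * g k).
Proof.
move=> [hb bg]; split=> [|k k6]; first exact: homogeneousZ.
by rewrite formZ bg.
Qed.

Lemma covectorD b c g h :
  covector b g -> covector c h -> covector (b + c) (fun k => g k + h k).
Proof.
move=> [hb bg] [hc ch]; split=> [|k k6]; first exact: homogeneousD.
by rewrite formD bg ?ch.
Qed.

Lemma covectorN b g : covector b g -> covector (- b) (fun k => - g k).
Proof.
move=> [hb bg]; split=> [|k k6]; first exact: homogeneousN.
by rewrite formN bg.
Qed.

Lemma e_set0 p : (\e_p : form K) set0 = 0.
Proof.
by rewrite ffunE; case: eqP => // /setP/(_ (inord p)); rewrite !inE eqxx.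
Qed.

End Coordinates.

(** * Necessary conditions for a listed representative to be closed *)

Section NecessaryConditions.
Variable R : realType.

Lemma entries_map (A : 'M[R]_5) f : entries A f ->
  entries (map_mx (real_complex R) A) (fun i j => (f i j)%:C).
Proof. by move=> Af i j; rewrite mxE Af. Qed.

Lemma spinor_closed_covector (A : 'M[R]_5) f (b w : form R[i]) g j :
  form_closed A (spinor b w) -> entries A f -> covector b g -> w finset.set0 = 0 ->
  (j < 5)%N -> \sum_(0 <= k < 5) (f k j)%:C * g k.+1 = 0.
Proof.
move=> cl Af [hb bg] w0 j5.
have j0 : inord j.+1 != 0 :> 'I_6 by rewrite -val_eqE /= inordK.
rewrite -[RHS](closed_covector _ hb cl j0); last by rewrite formZ w0 mulr0.
rewrite (sum_ad0 _ (entries_map Af)) // !big_mkord.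
by apply: eq_bigr => k _; rewrite bg // ltnS.
Qed.

Lemma spinor_closed_bivector (A : 'M[R]_5) f (b c w : form R[i]) g h i j :
  form_closed A (spinor (b ∧ c) w) -> entries A f -> covector b g -> covector c h ->
  w finset.set0 = 0 -> (i < j < 5)%N ->
  \sum_(0 <= k < 5) (f k i)%:C * (g k.+1 * h j.+1 - g j.+1 * h k.+1)
  + \sum_(0 <= k < 5) (f k j)%:C * (g i.+1 * h k.+1 - g k.+1 * h i.+1) = 0.
Proof.
move=> cl Af [hb bg] [hc ch] w0 /andP[ij j5]; have i5 := ltn_trans ij j5.
have ij6 : (0 < (inord i.+1 : 'I_6) < (inord j.+1 : 'I_6))%N by rewrite !inordK.
rewrite -[RHS](closed_bivector _ hb hc cl ij6); last by rewrite formZ w0 mulr0.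
rewrite big_split !(sum_ad0 _ (entries_map Af)) // !big_mkord.
by congr (_ + _); apply: eq_bigr => k _; rewrite !(bg, ch) // ltnS.
Qed.

Definition family_entries (F : family R) : nat -> nat -> R :=
  match F with
  | J3_1_1 l m n =>
      block_entries 3 (jordan_entries l) (block_entries 1 (fun _ _ => m) (fun _ _ => n))
  | J2_J2_1 l m n =>
      block_entries 2 (jordan_entries l) (block_entries 2 (jordan_entries m) (fun _ _ => n))
  | J2_1_1_1 l m n g =>
      block_entries 2 (jordan_entries l) (block_entries 1 (fun _ _ => m)
        (block_entries 1 (fun _ _ => n) (fun _ _ => g)))
  | C_J3 a b l => block_entries 2 (Cmx_entries a b) (jordan_entries l)
  | C_J2_1 a b l m =>
      block_entries 2 (Cmx_entries a b) (block_entries 2 (jordan_entries l) (fun _ _ => m))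
  | C_1_1_1 a b l m n =>
      block_entries 2 (Cmx_entries a b) (block_entries 1 (fun _ _ => l)
        (block_entries 1 (fun _ _ => m) (fun _ _ => n)))
  | Diagonal d1 d2 d3 d4 d5 =>
      block_entries 1 (fun _ _ => d1) (block_entries 1 (fun _ _ => d2)
        (block_entries 1 (fun _ _ => d3) (block_entries 1 (fun _ _ => d4) (fun _ _ => d5))))
  end.

Lemma entries_family F : entries (family_mx F) (family_entries F).
Proof.
have d m n := @entries_dsum R m n; have := (@entries_jordan R, @entries_Cmx R,
  @entries_blk1 R).
move=> [[J C] B]; case: F => *.
- exact: (d 3 2 _ _ _ _ (J _ _) (d 1 1 _ _ _ _ (B _) (B _)))%N.
- exact: (d 2 3 _ _ _ _ (J _ _) (d 2 1 _ _ _ _ (J _ _) (B _)))%N.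
- exact: (d 2 3 _ _ _ _ (J _ _) (d 1 2 _ _ _ _ (B _) (d 1 1 _ _ _ _ (B _) (B _))))%N.
- exact: (d 2 3 _ _ _ _ (C _ _) (J _ _))%N.
- exact: (d 2 3 _ _ _ _ (C _ _) (d 2 1 _ _ _ _ (J _ _) (B _)))%N.
- exact: (d 2 3 _ _ _ _ (C _ _) (d 1 2 _ _ _ _ (B _) (d 1 1 _ _ _ _ (B _) (B _))))%N.
- exact: (d 1 4 _ _ _ _ (B _) (d 1 3 _ _ _ _ (B _)
    (d 1 2 _ _ _ _ (B _) (d 1 1 _ _ _ _ (B _) (B _)))))%N.
Qed.

Lemma opposite_pairs_zeros (x : R) : two_opposite_pairs [:: 0; 0; x; - x].
Proof. by exists 0, x, [::]; rewrite oppr0. Qed.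

Lemma opposite_pairs_ends (x : R) : two_opposite_pairs [:: x; 0; 0; - x].
Proof.
exists x, 0, [::]; rewrite oppr0 perm_cons.
exact: (permEl (perm_catC [:: 0; 0] [:: - x])).
Qed.

Lemma opposite_pairs_zeros5 (x y : R) : two_opposite_pairs [:: 0; 0; x; y; - y].
Proof.
exists 0, y, [:: x]; rewrite oppr0 2!perm_cons.
exact: (permEl (perm_catC [:: x] [:: y; - y])).
Qed.

Lemma opposite_pairs_repeated (x y : R) : two_opposite_pairs [:: x; x; - x; y; - y].
Proof.
exists x, y, [:: x]; rewrite perm_cons.
exact: (permEl (perm_catC [:: x] [:: - x; y; - y])).
Qed.

Ltac set0_tac := by rewrite ?formD !wedge_set0 !e_set0 !mulr0 ?addr0.
Ltac coordinates :=
  rewrite /index_iota subn0 /= !big_cons !big_nil /block_entries /jordan_entries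
    /Cmx_entries /= ?(mulr0n, mulr1n, mulr0, mulr1, addr0, add0r, mul0r, mul1r, subr0,
      sub0r).
Ltac closed_covector_tac cl cb j :=
  have := @spinor_closed_covector _ _ _ _ _ j cl (entries_family _) cb
    ltac:(set0_tac) isT; coordinates.
Ltac closed_bivector_tac cl cb cc i j :=
  have := @spinor_closed_bivector _ _ _ _ _ _ _ i j cl (entries_family _) cb cc
    ltac:(set0_tac) isT; coordinates.

Local Notation e_ p := (@covector_e R[i] p isT).
Local Notation iZ := (@covectorZ R[i] 'i%C _ _).

(** Only the part of lowest degree of the spinor is used: [d Omega = 0] gives one
    scalar equation. With a rotation block, its real or its imaginary part says
    [b = 0]. Otherwise it forces an eigenvalue, or a sum of two eigenvalues, to
    vanish, and the resulting coincidences among the eigenvalues are excluded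
    by the pattern restrictions; the sole exception is the family in which [l]
    and [- l] have multiplicities two and three. *)
Lemma closed_representative c k (F : family R) Omega omega :
  representative c k F Omega omega -> pattern F ->
  form_closed (family_mx F) (spinor Omega omega) ->
  [/\ c = Case6b, k = 2%N & exists lambda alpha : R,
     [/\ F = J2_1_1_1 lambda alpha alpha (- lambda), alpha = - lambda & lambda <> 0]].
Proof.
have e45 := covectorD (e_ 4) (iZ (e_ 5)); have e34 := covectorD (e_ 3) (iZ (e_ 4)).
have e25 := covectorD (e_ 2) (iZ (e_ 5)); have e23 := covectorD (e_ 2) (iZ (e_ 3)).
have e12 := covectorD (e_ 1) (iZ (e_ 2)); have e03 := covectorD (e_ 0) (iZ (e_ 3)).
have ie02 := covectorD (iZ (e_ 0)) (e_ 2); have ie03 := covectorD (iZ (e_ 0)) (e_ 3).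
have e0m4 := covectorD (e_ 0) (covectorN (iZ (e_ 4))).
have e0m5 := covectorD (e_ 0) (covectorN (iZ (e_ 5))).
have e0eta := covectorD (e_ 0) e12.
have e01 (p : nat) (p6 : (p < 6)%N) :=
  covectorD (covectorD (e_ 0) (e_ 1)) (iZ (@covector_e R[i] p p6)).
case=> {c k F Omega omega}.
- move=> l m n -> <- pat cl; closed_covector_tac cl e45 3%N; case=> m0.
  by case: pat => //; rewrite m0 oppr0.
- move=> l m n -> <- pat cl; closed_bivector_tac cl ie03 e45 2%N 3%N; case=> re im.
  by case: pat => //; lra.
- move=> l m n -> -> [lm _ _] cl; closed_covector_tac cl e25 1%N; case=> l0.
  by case: lm; lra.
- move=> l m n -> -> [lm _ _] cl; closed_bivector_tac cl (e01 5 isT) ie02 1%N 4%N;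
  case=> re im.
  by case: lm; lra.
- move=> l m n g -> -> [_ + _] cl; closed_covector_tac cl e23 1%N; case=> l0; case.
  have -> : l = 0 by lra.
  exact: opposite_pairs_zeros.
- move=> l m n g -> -> [_ + _] cl; closed_bivector_tac cl (e01 3 isT) ie02 1%N 2%N;
  case=> re im; case.
  have -> : l = 0 by lra.
  exact: opposite_pairs_zeros.
- move=> l m n g a -> -> -> [_ + _] cl; closed_covector_tac cl e34 2%N; case=> a0; case.
  have -> : a = 0 by lra.
  exact: opposite_pairs_ends.
- move=> l m n g a -> -> -> [_ pat _] cl; closed_bivector_tac cl ie02 e34 1%N 2%N;
  case=> re im.
  have al : a = - l by lra.
  split=> //; exists l, a; split=> // l0; apply: pat.
  by rewrite al l0 oppr0; have := opposite_pairs_zeros 0; rewrite oppr0.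
- move=> l m n g -> <- [_ _ /(_ erefl) pat] cl; closed_covector_tac cl e34 2%N;
  case=> m0; case: pat.
  exists 0, [:: g]. have -> : m = 0 by lra. by rewrite oppr0.
- by move=> a b l b0 -> pat cl; closed_covector_tac cl e0eta 0%N; case=> re im; case: b0;
  lra.
- by move=> a b l b0 -> pat cl; closed_bivector_tac cl e12 e0m5 0%N 4%N; case=> re im;
  case: b0; lra.
- by move=> a b l m b0 lm pat cl; closed_covector_tac cl e0eta 0%N; case=> re im;
  case: b0; lra.
- by move=> a b l m b0 lm pat cl; closed_bivector_tac cl e12 e0m4 0%N 3%N; case=> re im;
  case: b0; lra.
- by move=> a b l m b0 lm pat cl; closed_covector_tac cl e0eta 0%N; case=> re im;
  case: b0; lra.
- by move=> a b l m b0 lm pat cl; closed_bivector_tac cl e12 e0m5 0%N 4%N; case=> re im;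
  case: b0; lra.
- by move=> a b l m n b0 lm pat cl; closed_covector_tac cl e0eta 0%N; case=> re im;
  case: b0; lra.
- by move=> a b l m n b0 lm pat cl; closed_bivector_tac cl e12 e0m5 0%N 4%N;
  case=> re im; case: b0; lra.
- move=> l m z [_ +] cl; closed_covector_tac cl e12 0%N; case=> l0; case.
  have -> : l = 0 by lra.
  exact: opposite_pairs_zeros5.
- move=> l m z [_ +] cl; closed_bivector_tac cl e12 e03 0%N 2%N; case=> re im; case.
  have -> : m = - l by lra.
  exact: opposite_pairs_repeated.
Qed.

End NecessaryConditions.

(** * The exceptional representative is closed *)

Section BlkClosed.
Import mathcomp.boot.finset.
Variable K : fieldType.
Implicit Types (S T U : {set 'I_6}).
Local Notation "''e^' S" := (monomial K S) (at level 8, S at level 2).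

Lemma dform_wedge_monomial0 (A : 'M[K]_5) S T :
  dform A 'e^(S :|: T) = 0 -> dform A ('e^S ∧ 'e^T) = 0.
Proof.
by move=> d; rewrite wedge_monomial; case: ifP => _; rewrite ?dform0 // dformZ d scaler0.
Qed.

Lemma dform_wedge3_monomial0 (A : 'M[K]_5) S T U :
  dform A 'e^(S :|: (T :|: U)) = 0 -> dform A ('e^S ∧ ('e^T ∧ 'e^U)) = 0.
Proof.
move=> d; rewrite [_ ∧ 'e^U]wedge_monomial; case: ifP => _; last by rewrite wedge0r dform0.
by rewrite wedgeZr dformZ dform_wedge_monomial0 ?scaler0.
Qed.

(** Spans of basis covectors are invariant under the transposed block as soon
    as they contain [e^2] with [e^1]; the differential is then governed by the
    trace on the span. *)
Lemma dform_blk_monomial0 (a b c : K) S : inord 0 \notin S ->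
  (inord 1 \in S -> inord 2 \in S) ->
  \sum_(k in S) (if (k <= 2)%N then a else c) = 0 ->
  dform (blk a b c) 'e^S = 0.
Proof.
have -> : inord 0 = 0 :> 'I_6 by apply: val_inj; rewrite /= inordK.
move=> S0 S12 tr.
have k0 k : k \in S -> (0 < k)%N.
  by move=> kS; rewrite lt0n; apply: contraNneq S0 => k0; rewrite (_ : 0 = k) //;
    exact: val_inj.
have entS (k : 'I_6) (m : 'I_6) : (0 < k)%N -> (0 < m)%N -> ad0 (blk a b c) k m =
    (if (k <= 2)%N then a else c) *+ (k == m) + b *+ ((k == inord 1) && (m == inord 2)).
  move=> k1 m1; rewrite (ad0E _ _ (entries_blk a b c)) k1 m1 /blk_entries.
  rewrite -!val_eqE /= !inordK //; case: (val k) (val m) k1 m1 => [|k'] [|m'] //=.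
rewrite dform_invariant_monomial //.
  rewrite (eq_bigr (fun k : 'I_6 => if (k <= 2)%N then a else c)) ?tr ?oppr0 ?scale0r //.
  move=> k kS; rewrite entS ?k0 // eqxx mulr1n.
  case: eqP => [->|] /=; last by rewrite mulr0n addr0.
  by rewrite -val_eqE /= !inordK // mulr0n addr0.
move=> k m kS mS; have [m0|m0] := posnP m.
  by rewrite (_ : m = 0) ?ad0_0r //; exact: val_inj.
rewrite entS ?(k0 k) //.
have -> : (k == m) = false by apply: contraNF mS => /eqP <-.
case: eqP => [kE|_]; last by rewrite addr0.
case: eqP => [mE|_]; last by rewrite addr0.
by rewrite mE S12 // -kE in mS.
Qed.

(** The representative is [(1 + i e^S) /\ (line) /\ (line)], each line being spanned
    by a combination of two basis covectors, so its closedness can be checked on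
    monomials, whose signs do not matter. *)
Lemma dform_wedge_lines0 (A : 'M[K]_5) S p1 p2 q1 q2 x1 x2 y1 y2 :
  (forall p q, p \in [set p1; p2] -> q \in [set q1; q2] ->
     dform A 'e^(S :|: ([set p] :|: [set q])) = 0) ->
  dform A ('e^S ∧ ((x1 *: 'e^[set p1] + x2 *: 'e^[set p2])
                    ∧ (y1 *: 'e^[set q1] + y2 *: 'e^[set q2]))) = 0.
Proof.
move=> d; rewrite wedgeDl wedgeDr dformD; set a := y1 *: _ + _.
have E p x : p \in [set p1; p2] -> dform A ('e^S ∧ (x *: 'e^[set p] ∧ a)) = 0.
  move=> pP; rewrite wedgeZl wedgeZr dformZ wedgeDr wedgeDr dformD.
  rewrite 2!wedgeZr 2!wedgeZr 2!dformZ !dform_wedge3_monomial0 ?scaler0 ?addr0 ?scaler0 //;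
    by apply: d; rewrite // !inE eqxx ?orbT.
by rewrite !E ?addr0 // !inE eqxx ?orbT.
Qed.

End BlkClosed.

Section ExceptionalFamily.
Import mathcomp.boot.finset.
Variables (R : realType) (l : R).

(** The covectors of each monomial either include [e^0] or span an invariant
    space on which the eigenvalues [l] and [- l] occur equally often. *)
Lemma exceptional_closed : form_closed (blk l 1 (- l))
  (spinor (('i%C *: \e_0 + \e_2) ∧ (\e_3 + 'i%C *: \e_4)) (\e_1 ∧ \e_5)).
Proof.
rewrite /form_closed map_blk /spinor.
have [s ->] : exists s : R[i], \e_1 ∧ \e_5 = s *: monomial R[i] [set inord 1; inord 5].
  by rewrite wedge_monomial; case: ifP => _; [eexists | exists 0; rewrite scale0r].
rewrite scalerA expform_monomial; last by apply/set0Pn; exists (inord 1); rewrite !inE eqxx.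
rewrite -[X in 'i%C *: \e_0 + X]scale1r -[X in X + 'i%C *: \e_4]scale1r.
rewrite wedgeDl wedgeZl dformD dformZ.
have d (S : {set 'I_6}) p q : p \in [set inord 0; inord 2] ->
    q \in [set inord 3; inord 4] -> S = set0 \/ S = [set inord 1; inord 5] ->
    dform (blk l%:C (1%R)%:C (- l)%:C) (monomial R[i] (S :|: ([set p] :|: [set q]))) = 0.
  rewrite !in_set2 => /orP[/eqP ->|/eqP ->] qP SP.
    by apply: dform_monomial_0; rewrite !inE -!val_eqE /= inordK // eqxx orbT.
  apply: dform_blk_monomial0.
  - by case: SP qP => -> /orP[]/eqP ->; rewrite !inE -!val_eqE /= !inordK.
  - by rewrite !inE eqxx !orbT.
  case: SP qP => -> /orP[]/eqP ->;
    by rewrite big_mkcond !big_ord_recl big_ord0 !inE -!val_eqE /= !inordK //= raddfN /=;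
      ring.
rewrite !dform_wedge_lines0 ?scaler0 ?addr0 // => p q pP qP; apply: d => //;
  by [left | right].
Qed.
End ExceptionalFamily.

(** Two identical pairs would make the multiplicity of [l] even, and two opposite
    pairs would make the sum of the entries vanish; but [l] is a simple entry
    and the sum is [- 2 l]. *)
Lemma exceptional_pattern (R : realType) (l : R) : l <> 0 ->
  pattern (J2_1_1_1 l (- l) (- l) (- l)).
Proof.
move=> l0; have size4 (s t : seq R) : size s = 4%N ->
    perm_eq [:: l; - l; - l; - l] (s ++ t) -> t = [::].
  move=> s4 /perm_size; rewrite size_cat s4 => E; apply: size0nil.
  by move: E; case: (size t).
split=> [[r [s [t p]]]|[r [s [t p]]]|//].
- have Nl : (- l == l) = false.
    by apply/eqP => /eqP; rewrite -subr_eq0 -opprD oppr_eq0 -mulr2n mulrn_eq0 => /eqP.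
  have /permP/(_ (pred1 l)) := p; rewrite (size4 _ _ _ p) //= eqxx Nl.
  by case: (r == l); case: (s == l).
- have : \sum_(x <- [:: l; - l; - l; - l]) x = \sum_(x <- [:: r; - r; s; - s] ++ t) x.
    exact: perm_big.
  by rewrite (size4 _ _ _ p) // !big_cons !big_nil => E; apply: l0; lra.
Qed.

(** * The exceptional algebra has no invariant complex structure *)

Section NoComplex.
Variables (R : realType) (l : R).
Hypothesis l0 : l != 0.
Let A := blk l 1 (- l).
Let hix (k : 'I_5) : 'I_6 := @rshift 1 5 k.
Let ad (X : 'cV[R]_6) : 'cV[R]_6 := @col_mx R 1 5 1 0 (A *m hpart X).

Let hix_eq i j : (hix i == hix j) = (i == j).
Proof. by rewrite /hix -!val_eqE /= eqn_add2l. Qed.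

Lemma bracketE (X Y : 'cV[R]_6) :
  bracket A X Y = e0coord X *: ad Y - e0coord Y *: ad X.
Proof.
by rewrite /bracket /ad (@scale_col_mx R 1 5) (@scale_col_mx R 1 5) (@opp_col_mx R 1 5)
  (@add_col_mx R 1 5) !scaler0 subr0.
Qed.

Lemma e0coord_ad X : e0coord (ad X) = 0.
Proof.
rewrite /e0coord; have -> : ord0 = @lshift 1 5 0 by exact: val_inj.
by rewrite (@col_mxEu R 1 5) mxE.
Qed.

Lemma adE X k : ad X (hix k) 0 =
  (if (k < 2)%N then l else - l) * X (hix k) 0 + X (hix 1) 0 *+ (k == 0).
Proof. by rewrite (@col_mxEd R 1 5) blk_mulE mxE !mxE mul1r. Qed.

Lemma eq_cV6 (X Y : 'cV[R]_6) : e0coord X = e0coord Y ->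
  (forall k, X (hix k) 0 = Y (hix k) 0) -> X = Y.
Proof.
move=> e0 eh; apply/colP => i; case: (@split_ordP 1 5 i) => k ->; last exact: eh.
by move: e0; rewrite /e0coord (_ : ord0 = @lshift 1 5 k) //; apply: val_inj; rewrite ord1.
Qed.

Let e1 : 'cV[R]_6 := bvec R (hix 0).

(** The square of [ad e_0] is scalar on the ideal up to a rank one map with image
    the line of [e_1]. *)
Lemma ad_square X : e0coord X = 0 ->
  ad (ad X) - l ^+ 2 *: X = (2 * l * X (hix 1) 0) *: e1.
Proof.
move=> X0; apply: eq_cV6 => [|k].
  by move: (e0coord_ad (ad X)) X0; rewrite /e0coord !mxE /= => -> ->; rewrite !mulr0 subr0.
rewrite addmxE oppmxE !adE [(l ^+ 2 *: X) _ _]mxE [RHS]mxE [e1 _ _]mxE hix_eq.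
by case: k => [[|[|k]] Hk] //=; rewrite ?mulr0n ?mulr1n; ring.
Qed.

(** On the kernel of the rank one map above, [ad e_0] itself is scalar up to
    a rank one map with the same image. *)
Lemma ad_shift X : e0coord X = 0 -> X (hix 1) 0 = 0 ->
  ad X + l *: X = (2 * l * X (hix 0) 0) *: e1.
Proof.
move=> X0 X1; apply: eq_cV6 => [|k].
  by move: (e0coord_ad X) X0; rewrite /e0coord !mxE /= => -> ->; rewrite !mulr0 addr0.
rewrite addmxE !adE X1 [(l *: X) _ _]mxE [RHS]mxE [e1 _ _]mxE hix_eq.
case: k => [[|[|k]] Hk] //=; rewrite ?mulr0n ?mulr1n; last by ring.
  have -> : Ordinal Hk = 0 by exact: val_inj.
  by ring.
have -> : Ordinal Hk = 1 by exact: val_inj.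
by rewrite X1; ring.
Qed.

(** For an integrable [J] and the ideal [h], integrability tested against a
    vector [v] of [h] with [J v] outside [h] says that [ad e_0] commutes with
    [J] on [h :&: J h]. A real rank one map that commutes with [J] must vanish:
    otherwise its image, the line of [e_1], would be [J]-stable, although [J]
    has no real eigenvalue. Applied to [ad_square] and then [ad_shift], this
    kills both coordinates of every vector of [h :&: J h] along [e_1] and
    [e_2]; but one linear condition cannot exclude the whole plane of [e_1] and
    [e_2] from [h :&: J h]. *)
Lemma no_complex_blk : ~ (exists J, complex_structure A J).
Proof.
move=> [J [JJ NJ]].
have JK (X : 'cV[R]_6) : J *m (J *m X) = - X by rewrite mulmxA JJ mulNmx mul1mx.
have Je1 r : J *m e1 <> r *: e1.
  move=> Jr; have := JK e1; rewrite Jr -scalemxAr Jr scalerA => /colP/(_ (hix 0)).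
  rewrite !mxE eqxx /=; have := sqr_ge0 r; rewrite expr2; lra.
have Je1s a b : a *: (J *m e1) = b *: e1 -> a = 0 /\ b = 0.
  move=> ab; have a0 : a = 0.
    apply/eqP; apply: contrapT => /negP an; apply: (Je1 (a^-1 * b)).
    by rewrite -scalerA -ab scalerA mulVf // scale1r.
  split=> //; move: ab; rewrite a0 scale0r => /esym/colP/(_ (hix 0)).
  by rewrite !mxE eqxx mulr1.
have [v v0 Jv] : exists2 v, e0coord v = 0 & e0coord (J *m v) != 0.
  apply: contrapT => nv.
  have J0 k : J ord0 (hix k) = 0.
    apply/eqP; apply: contrapT => /negP Jk; apply: nv; exists (bvec R (hix k)).
      by rewrite /e0coord mxE.
    by rewrite /e0coord /bvec -colE mxE.
  have /matrixP/(_ ord0 ord0) := JJ; rewrite !mxE (@big_split_ord _ _ _ 1 5).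
  rewrite big_ord1 /= [X in _ + X]big1 => [|k _]; last by rewrite J0 mul0r.
  rewrite (_ : lshift 5 0 = ord0); last exact: val_inj.
  have := sqr_ge0 (J ord0 ord0); rewrite expr2; lra.
(* commutation on [h :&: J h], from the vanishing of the Nijenhuis tensor at [(v, Y)] *)
have adJ Y : e0coord Y = 0 -> e0coord (J *m Y) = 0 -> ad (J *m Y) = J *m ad Y.
  move=> Y0 JY0; have := NJ v Y.
  rewrite !bracketE v0 Y0 JY0 !scale0r !subr0 mulmx0 !subr0 -scalemxAr.
  by move/eqP; rewrite -scalerBr scaler_eq0 (negPf Jv) /= subr_eq0 => /eqP.
(* a nonzero vector of the plane of [e_1], [e_2] that [J] keeps in the ideal *)
pose p := if J ord0 (hix 0) == 0 then 1 else J ord0 (hix 1).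
pose q := if J ord0 (hix 0) == 0 then 0 else - J ord0 (hix 0).
pose Y : 'cV[R]_6 := p *: bvec R (hix 0) + q *: bvec R (hix 1).
have Y0 : e0coord Y = 0 by rewrite /e0coord !mxE /= !mulr0 addr0.
have JY0 : e0coord (J *m Y) = 0.
  rewrite /e0coord mulmxDr -!scalemxAr /bvec -!colE !mxE /p /q.
  by case: eqP => [->|_]; ring.
have aY : ad (J *m Y) = J *m ad Y by exact: adJ.
have aaY : ad (ad (J *m Y)) = J *m ad (ad Y).
  by rewrite aY adJ ?e0coord_ad // -aY e0coord_ad.
have sq : (2 * l * (J *m Y) (hix 1) 0) *: e1 = (2 * l * Y (hix 1) 0) *: (J *m e1).
  by rewrite -(ad_square JY0) aaY [RHS]scalemxAr -(ad_square Y0) mulmxBr -scalemxAr.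
have l2 x : 2 * l * x = 0 -> x = 0.
  by move/eqP; rewrite !mulf_eq0 pnatr_eq0 (negPf l0) => /eqP.
have [Y1 JY1] : Y (hix 1) 0 = 0 /\ (J *m Y) (hix 1) 0 = 0.
  by move/esym/Je1s: sq => -[/l2 -> /l2 ->].
have sh : (2 * l * (J *m Y) (hix 0) 0) *: e1 = (2 * l * Y (hix 0) 0) *: (J *m e1).
  by rewrite -(ad_shift JY0 JY1) aY [RHS]scalemxAr -(ad_shift Y0 Y1) [RHS]mulmxDr
    -scalemxAr.
have {}Y0 : Y (hix 0) 0 = 0.
  by move/esym/Je1s: sh => -[/l2].
move: Y0 Y1; rewrite /Y !mxE !hix_eq /= !mulr0 !mulr1 addr0 add0r /p /q.
case: eqVneq => [_ /eqP|nz _ /eqP]; first by rewrite oner_eq0.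
by rewrite oppr_eq0 (negPf nz).
Qed.
End NoComplex.

(** * The exceptional algebra has no invariant symplectic structure *)

Section NoSymplectic.
Variables (R : realType) (l : R).
Hypothesis l0 : l != 0.
Let A := blk l 1 (- l).

Lemma eval2E (w : form R) X Y :
  eval2 w X Y = \sum_j (\sum_i coef2 w i j * X i 0) * Y j 0.
Proof.
rewrite /eval2 (sum_coef2 w (fun i j => X i 0 * Y j 0)) exchange_big.
by apply: eq_bigr => j _; rewrite mulr_suml; apply: eq_bigr => i _; rewrite mulrA.
Qed.

Lemma coef2_swap (w : form R) i j : coef2 w j i = - coef2 w i j.
Proof. by rewrite /coef2 finset.setUC opprB. Qed.

(** Closedness makes [ad e_0] skew for the restriction of [w] to the ideal, so two
    generalized eigenvectors pair to zero unless their eigenvalues are opposite;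
    moreover [e_1 = (ad e_0 - l) e_2] pairs to zero with the [- l]-eigenspace.
    Hence [e_1], [e_3] and [e_4] pair trivially with all basis vectors but [e_0]
    and [e_2]: two linear conditions, which some nonzero combination of the
    three vectors satisfies. *)
Lemma no_symplectic_blk : ~ (exists w, symplectic_structure A w).
Proof.
move=> [w [_ dw nd]].
pose af := blk_entries l 1 (- l).
pose W i j := coef2 w (inord i) (inord j).
have WN i j : W j i = - W i j by exact: coef2_swap.
have W0 i : W i i = 0 by rewrite /W /coef2 ltnn subrr.
have inv i j : (i < j < 5)%N ->
    \sum_(0 <= k < 5) af k i * W k.+1 j.+1 + \sum_(0 <= k < 5) af k j * W i.+1 k.+1 = 0.
  move=> /andP[ij j5]; have i5 := ltn_trans ij j5.
  have ij6 : (0 < (inord i.+1 : 'I_6) < (inord j.+1 : 'I_6))%N by rewrite !inordK.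
  apply/eqP; rewrite -oppr_eq0; apply/eqP.
  rewrite -[RHS](_ : dform A w [set 0; inord i.+1; inord j.+1] = 0);
    last by rewrite dw ffunE.
  by rewrite dform2E // big_split !(sum_ad0 _ (entries_blk _ _ _)) // !big_mkord.
have invE i j : (i < j < 5)%N ->
    ((if (i < 2)%N then l else - l) + (if (j < 2)%N then l else - l)) * W i.+1 j.+1
      + W 1%N j.+1 *+ (i == 1%N) = 0.
  move=> /[dup] ij5 /andP[ij j5]; have := inv i j ij5;
    rewrite /index_iota subn0 /= !big_cons !big_nil /af /blk_entries.
  move: ij {ij5}; case: j j5 => [|[|[|[|[|j]]]]] // _; case: i => [|[|[|[|i]]]] // _;
    rewrite /= ?W0 ?(mulr0n, mulr1n, mul0r, addr0, add0r, mul1r);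
    by move=> E; rewrite -[RHS]E; ring.
have l2 x : (l + l) * x = 0 -> x = 0.
  by move/eqP; rewrite -mulr2n mulf_eq0 mulrn_eq0 /= (negPf l0) => /eqP.
have W12 : W 1%N 2%N = 0 by have /= := invE 0%N 1%N isT; rewrite addr0 => /l2.
have W1 j : (2 <= j < 5)%N -> W 1%N j.+1 = 0.
  move=> /andP[j2 j5]; have := invE 1%N j; rewrite j2 j5 => /(_ isT).
  by rewrite /= (leq_gtF j2) subrr mul0r add0r.
have W0' i j : (2 <= i < j)%N -> (j < 5)%N -> W i.+1 j.+1 = 0.
  move=> /andP[i2 ij] j5; have := invE i j; rewrite ij j5 => /(_ isT).
  rewrite (leq_gtF i2) (leq_gtF (ltnW (leq_ltn_trans i2 ij))) /= (gtn_eqF i2) addr0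
    -opprD mulNr => /eqP.
  by rewrite oppr_eq0 => /eqP/l2.
pose p k := W k 0%N; pose q k := W k 2%N.
(* solution of [x3 * q 3 + x4 * q 4 = 0]; [x1] is then fixed by the other condition *)
pose x3 := if q 3 == 0 then 1 else q 4.
pose x4 := if q 3 == 0 then 0 else - q 3.
have x34 : x3 * q 3 + x4 * q 4 = 0 by rewrite /x3 /x4; case: eqP => [->|_]; ring.
have x34n : ~ (x3 = 0 /\ x4 = 0).
  rewrite /x3 /x4; case: eqVneq => [_ [/eqP]|q3 [_ /eqP]]; first by rewrite oner_eq0.
  by rewrite oppr_eq0 (negPf q3).
pose s := x3 * p 3 + x4 * p 4.
have coefX (f : 'I_6 -> R) k : \sum_i f i * bvec R k i 0 = f k.
  rewrite (bigD1 k) //= big1 => [|i ik]; first by rewrite mxE !eqxx mulr1 addr0.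
  by rewrite mxE (negPf ik) mulr0.
have degenerate x1 y3 y4 : x1 * p 1%N + y3 * p 3 + y4 * p 4 = 0 ->
    y3 * q 3 + y4 * q 4 = 0 -> [/\ x1 = 0, y3 = 0 & y4 = 0].
  move=> E0 E2.
  pose X : 'cV[R]_6 := x1 *: bvec R (inord 1) + y3 *: bvec R (inord 3)
    + y4 *: bvec R (inord 4).
  have X0 : X = 0.
    apply: nd => Y; rewrite eval2E big1 // => j _.
    have -> : \sum_i coef2 w i j * X i 0 =
        x1 * W 1%N j + y3 * W 3 j + y4 * W 4 j.
      rewrite /W inord_val -!(coefX (fun i => coef2 w i j)) !mulr_sumr -!big_split /=.
      by apply: eq_bigr => i _; rewrite !mxE; ring.
    case: j => [[|[|[|[|[|[|j]]]]]] jP] //=.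
    - by rewrite E0 mul0r.
    - by rewrite W0 (WN 1%N 3) (WN 1%N 4) !W1 // oppr0 !mulr0 !addr0 mul0r.
    - by rewrite W12 mulr0 add0r E2 mul0r.
    - by rewrite W1 // W0 (WN 3 4) W0' // oppr0 !mulr0 !addr0 mul0r.
    - by rewrite W1 // W0 W0' // !mulr0 !addr0 mul0r.
    - by rewrite W1 // !W0' // !mulr0 !addr0 mul0r.
  have XE k : X k 0 = 0 by rewrite X0 mxE.
  have ne (a b : nat) : (a < 6)%N -> (b < 6)%N -> (inord a == inord b :> 'I_6) = (a == b).
    by move=> a6 b6; rewrite -val_eqE /= !inordK.
  move: (XE (inord 1)) (XE (inord 3)) (XE (inord 4)); rewrite !mxE !ne //=.
  by rewrite !(mulr1, mulr0, addr0, add0r) => -> -> ->.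
have [p1|p1] := eqVneq (p 1%N) 0.
  have [||/eqP] := @degenerate 1 0 0; rewrite ?p1; try ring.
  by rewrite oner_eq0.
have [||_ x30 x40] := @degenerate (- s / p 1%N) x3 x4 => //.
  by rewrite divfK // /s; ring.
by apply: x34n.
Qed.
End NoSymplectic.

(** * The exponential of the exceptional matrix *)

Section Mexp.
Variable R : realType.

Lemma blk_lin (a b c : R) : blk a b c = a *: blk 1 0 0 + b *: blk 0 1 0 + c *: blk 0 0 1.
Proof. by rewrite !blkZ !blkD !(mulr0, mulr1, addr0, add0r). Qed.

Lemma series_blk (u v w : nat -> R) :
  series (fun n => blk (u n) (v n) (w n)) =
  (fun n => blk (series u n) (series v n) (series w n)).
Proof.
apply/funext => n; elim: n => [|n IHn].
  by rewrite /series /= !big_geq // blk_lin !scale0r !addr0.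
by rewrite !seriesSr IHn blkD.
Qed.

Lemma cvg_blk (T : Type) (F : set_system T) (FF : Filter F) (u v w : T -> R) (a b c : R) :
  (u @ F --> a -> v @ F --> b -> w @ F --> c ->
   blk (u n) (v n) (w n) @[n --> F] --> blk a b c)%classic.
Proof.
move=> ua vb wc; rewrite [blk a b c]blk_lin.
under eq_cvg do rewrite blk_lin.
by apply: cvgD; [apply: cvgD|]; exact: cvgZr_tmp.
Qed.

(** The three components of the exponential series are scalar series; the
    nilpotent one is the exponential series shifted by one index. *)
Lemma mexp_blk (l m t : R) :
  mexp (t *: blk l 1 m) = blk (expR (t * l)) (t * expR (t * l)) (expR (t * m)).
Proof.
have exp_cvg (x : R) : (series (exp_coeff x) @ \oo --> expR x)%classic.
  exact: is_cvg_series_exp_coeff.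
rewrite /mexp; apply: cvg_lim => //.
pose b (n : nat) : R := if n is k.+1 then t * exp_coeff (t * l) k else 0.
rewrite [X in series X](_ : _ =
    fun n => blk (exp_coeff (t * l) n) (b n) (exp_coeff (t * m) n)); last first.
  apply/funext => n; rewrite blkZ mulr1 blkX blkZ /exp_coeff /=.
  congr blk; rewrite 1?mulrC //.
  case: n => [|n] /=; first by rewrite mulr0n mulr0 mul0r.
  rewrite factS natrM -[_ *+ n.+1]mulr_natl -[exp_coeff _ n]/((t * l) ^+ n / n`!%:R).
  have nf : n`!%:R != 0 :> R by rewrite pnatr_eq0 -lt0n fact_gt0.
  have nS : n.+1%:R != 0 :> R by rewrite pnatr_eq0.
  by move: (n.+1%:R : R) (n`!%:R : R) nS nf => p q p0 q0; field; rewrite p0 q0.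
rewrite series_blk; apply: cvg_blk; try exact: exp_cvg.
rewrite -cvg_shiftS.
rewrite [X in (X @ \oo)%classic](_ : _ = fun n => t * series (exp_coeff (t * l)) n).
  by apply: cvgMl_tmp; exact: exp_cvg.
apply/funext => n; rewrite /series /= big_nat_recl // add0r mulr_sumr.
by apply: eq_big_nat.
Qed.

End Mexp.

(** * Lattices and unimodularity *)

Section Lattices.
Variables (R : realType) (A : 'M[R]_5) (Gamma : set (GA R)).
Let E t := mexp (t *: A).
Hypothesis E0 : E 0 = 1%:M.
Hypothesis ED : forall s t, E (s + t) = E s *m E t.
Hypothesis latG : lattice A Gamma.

(** Such a function descends to the compact space of cosets. *)
Lemma invariant_bounded (f : GA R -> R) : continuous f ->
  (forall g x, Gamma g -> f (Gmul A g x) = f x) ->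
  exists M, forall x, `|f x| <= M.
Proof.
move=> fc fi; case: latG => -[G1 _ _] _ Kc.
have fK (x y : GA R) : same_coset A Gamma x y -> f x = f y.
  move=> /asboolP exy; have : Gcoset A Gamma y x.
    rewrite -exy; exists (Gone R) => //.
    by rewrite /Gmul /= add0r -/(E 0) E0 mul1mx add0r -surjective_pairing.
  by case=> g Gg <-; exact: fi.
have hf : {homo f : a b / (a == b %[mod (coset_space A Gamma)])%qT >-> a == b}.
  by move=> a b /eqP /(@eqmodP _ (same_coset_equiv_rel A Gamma)) /fK ->.
have := continuous_compact (continuous_subspaceT (repr_comp_continuous fc hf)) Kc.
move=> /compact_bounded [M [Mr MB]]; exists (M + 1) => x.
apply: (MB (M + 1)); first by rewrite ltrDl.
exists (\pi_(coset_space A Gamma) x)%qT => //=.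
by apply/eqP/hf; rewrite reprK.
Qed.

Let translation (v : 'cV[R]_5) := Gamma (0, v).

Let EK t : E t *m E (- t) = 1%:M.
Proof. by rewrite -ED subrr E0. Qed.

Let GammaM s a t b : Gamma (s, a) -> Gamma (t, b) -> Gamma (s + t, a + E s *m b).
Proof. by case: latG => -[_ GM _] _ _; exact: GM. Qed.

Let GammaV s a : Gamma (s, a) -> Gamma (- s, - (E (- s) *m a)).
Proof. by case: latG => -[_ _ GV] _ _; exact: GV. Qed.

(** Two elements with the same first coordinate differ by a translation. Applied
    to the two products of a pair of elements, this turns commutators into
    translations. *)
Lemma translation_diff s a b : Gamma (s, a) -> Gamma (s, b) -> translation (a - b).
Proof.
move=> Ga /GammaV/(GammaM Ga).
by rewrite subrr mulmxN mulmxA EK mul1mx.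
Qed.

Lemma translation0 : translation 0.
Proof. by case: latG => -[]. Qed.

Lemma translationB v w : translation v -> translation w -> translation (v - w).
Proof. exact: translation_diff. Qed.

Lemma translationMn v k : translation v -> translation (v *+ k).
Proof.
move=> Lv; elim: k => [|k IHk]; first exact: translation0.
rewrite mulrSr -[v in _ + v]opprK; apply: translationB => //.
by rewrite -sub0r; apply: translationB => //; exact: translation0.
Qed.

Lemma translationMz v k : translation v -> translation (v *~ k).
Proof.
case: k => k Lv; first exact: translationMn.
rewrite NegzE mulrNz -sub0r; apply: translationB; first exact: translation0.
exact: translationMn.
Qed.

Lemma translation_conj t u v : Gamma (t, u) -> translation v -> translation (E t *m v).
Proof.
move=> Gt /(GammaM Gt); rewrite addr0 => /translation_diff/(_ Gt).
by rewrite addrC addKr.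
Qed.

Lemma translation_discrete : exists2 e : R, 0 < e &
  forall v, translation v -> (forall i, `|v i 0| < e) -> v = 0.
Proof.
case: latG => -[G1 _ _] /(_ _ G1) [_ [V /nbhs_ballP[e e0 eV] VG]] _.
exists e => // v Lv ve; have: (V `&` Gamma)%classic (0, v).
  split=> //; apply: eV; split => /=; first exact: ballxx.
  split=> // i j; rewrite ord1 mxE -ball_normE /ball_ /= sub0r normrN.
  exact: ve.
by rewrite VG => -[].
Qed.

(** Otherwise the first coordinate would be an unbounded invariant function. *)
Lemma translation_part_neq0 : exists t v, t != 0 /\ Gamma (t, v).
Proof.
apply: contrapT => nG.
have [|g x Gg|M fM] := @invariant_bounded fst; first by move=> x; exact: cvg_fst.
  rewrite /= -[RHS]add0r; congr (_ + _); apply/eqP; apply: contrapT => /negP g0.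
  by apply: nG; exists g.1, g.2; rewrite -surjective_pairing.
have := fM (`|M| + 1, 0) => /=.
rewrite ger0_norm ?addr_ge0 // => /le_trans/(_ (ler_norm M)).
by rewrite gerDl ler10.
Qed.

(** These are the features of the one-parameter group used below: for
    [t != 0], [E t] has no fixed vector and generates an algebra containing all
    the [E s]. *)
Hypothesis Econt : continuous E.
Hypothesis Efix : forall t : R, t != 0 -> 1%:M - E t \in unitmx.
Hypothesis Epoly : forall s t : R, t != 0 -> exists p : {poly R}, E s = horner_mx (E t) p.

(** Let [l] vanish on all translations, let [c] be the fixed point of an element
    with first coordinate [t0 != 0], and [M = E t0]. Commutators with that
    element are the translations by [(1 - M)] times the displacements of [c], so
    [k = l (1 - M)] vanishes on all displacements of [c]. So do [k M] and, [E s]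
    being a polynomial in [M], all the [k (E s)]. Then
    [(t, x) |-> k (E (- t)) (x - c)] is invariant under the lattice, continuous and
    unbounded. *)
Lemma translations_span (l : 'rV[R]_5) : l != 0 ->
  exists2 v, translation v & (l *m v) 0 0 != 0.
Proof.
move=> l0; have [t0 [v0 [t00 G0]]] := translation_part_neq0.
apply: contrapT => lL.
have {}lL v : translation v -> l *m v = 0.
  move=> Lv; apply/matrixP => i j; rewrite !ord1 [RHS]mxE.
  by apply/eqP; apply: contrapT => /negP lv; apply: lL; exists v.
set M := E t0 in G0; have Mu : 1%:M - M \in unitmx by exact: Efix.
(* [c] is the fixed point of [(t0, v0)] acting on the ideal by affine maps *)
have [c v0E] : exists c, v0 = (1%:M - M) *m c.
  by exists (invmx (1%:M - M) *m v0); rewrite mulKVmx.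
(* [P k]: the row [k] vanishes on all displacements of [c] *)
pose P (k : 'rV[R]_5) := forall s w, Gamma (s, w) -> k *m (w + E s *m c - c) = 0.
have PM k : P k -> P (k *m M).
  move=> Pk s w Gsw; have := Pk _ _ (GammaM G0 Gsw).
  rewrite -[k *m M *m _]mulmxA ED -[E t0 *m _ *m _]mulmxA v0E => <-; congr (k *m _).
  rewrite -/M mulmxBl mul1mx !mulmxDr !mulmxA mulmxN.
  by mx_zmod.
have Ppoly k (p : {poly R}) : P k -> P (k *m horner_mx M p).
  move=> Pk; elim/poly_ind: p => [|p a IHp].
    by move=> s w _; rewrite rmorph0 mulmx0 mul0mx.
  move=> s w Gsw; rewrite rmorphD rmorphM /= horner_mx_X horner_mx_C.
  rewrite [k *m _]mulmxDr mulmxDl -[_ * M]/(_ *m M) mulmxA (PM _ IHp) // add0r.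
  by rewrite mul_mx_scalar -scalemxAl Pk ?scaler0.
pose k := l *m (1%:M - M).
have k0 : k != 0.
  by apply: contraNneq l0 => k0; rewrite -(mulmxK Mu l) -/k k0 mul0mx.
have Pk : P k.
  move=> s w Gsw; rewrite -mulmxA; apply: lL.
  have := translation_diff (GammaM Gsw G0).
  rewrite addrC => /(_ _ (GammaM G0 Gsw)).
  by congr translation; rewrite v0E -/M !(mulmxBr, mulmxBl, mulmxDr, mulmxDl, mul1mx,
    mulmxN, mulNmx) !mulmxA /M -!ED [s + t0]addrC; mx_zmod.
clearbody k; have PE s : P (k *m E s) by have [p ->] := Epoly s t00; exact: Ppoly.
have [||B fB] := @invariant_bounded (fun x => (k *m E (- x.1) *m (x.2 - c)) 0 0).
- move=> x; rewrite /continuous_at [X in (X @ _)%classic](_ : _ = fun y : GA R =>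
      \sum_i (\sum_j k 0 j * E (- y.1) j i) * (y.2 i 0 - c i 0)); last first.
    by apply/funext => y; rewrite mxE; apply: eq_bigr => i _; rewrite !mxE.
  rewrite mxE; apply: (cvg_big (op := +%R)) => [|i _]; first exact: add_continuous.
  rewrite !mxE; apply: cvgM.
    apply: (cvg_big (op := +%R)) => [|j _]; first exact: add_continuous.
    apply: cvgMl_tmp; apply: (@continuous_comp _ _ _ (fun y : GA R => - y.1)
      (fun t => E t j i)); last first.
      apply: (@continuous_comp _ _ _ E (fun M : 'M[R]_5 => M j i)); first exact: Econt.
      exact: coord_continuous.
    by apply: cvgN; exact: cvg_fst.
  apply: cvgB; last exact: cvg_cst.
  apply: (@continuous_comp _ _ _ snd (fun v : 'cV[R]_5 => v i 0)).
    exact: cvg_snd.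
  exact: coord_continuous.
- move=> [s w] [t x] Gsw /=.
  have -> : w + E s *m x - c = (w + E s *m c - c) + E s *m (x - c).
    by rewrite mulmxBr; mx_zmod.
  rewrite mulmxDr PE // add0r -!mulmxA (mulmxA (E _)) -ED.
  by rewrite opprD addrAC addNr add0r.
have [i ki] : exists i, k 0 i != 0.
  by apply/rV0Pn.
have := fB (0, c + ((`|B| + 1) / k 0 i) *: delta_mx i 0) => /=.
rewrite oppr0 E0 mulmx1 addrC addKr -scalemxAr -colE !mxE divfK //.
rewrite ger0_norm ?addr_ge0 // => /le_trans/(_ (ler_norm B)).
by rewrite gerDl ler10.
Qed.

Lemma translations_basis : exists2 B, B \in unitmx & forall i, translation (col i B).
Proof.
suff H k : (k <= 5)%N -> exists2 B : 'M[R]_(5, k), \rank B = k &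
    forall i, translation (col i B).
  have [B rB LB] := H 5 isT; exists B => //.
  by rewrite -row_full_unit /row_full rB.
elim: k => [|k IHk] k5.
  by exists 0; [rewrite mxrank0 | case].
have [B rB LB] := IHk (ltnW k5).
have [l l0 lB] : exists2 l : 'rV[R]_5, l != 0 & l *m B = 0.
  have /rowV0Pn[l /sub_kermxP lB l0] : kermx B != 0.
    by rewrite -mxrank_eq0 mxrank_ker rB subn_eq0 -ltnNge.
  by exists l.
have [v Lv lv] := translations_span l0.
have ltr : (\rank B < \rank (row_mx B v))%N.
  rewrite -(mxrank_tr B) -(mxrank_tr (row_mx _ _)) tr_row_mx ltnNge.
  have /mxrank_leqif_sup/geq_leqif -> : (B^T <= col_mx B^T v^T)%MS.
    by have := submx_refl (col_mx B^T v^T); rewrite col_mx_sub => /andP[].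
  apply: contra lv; rewrite col_mx_sub => /andP[_ /submxP[D vD]].
  by rewrite -[v]trmxK vD trmx_mul trmxK mulmxA lB mul0mx mxE.
rewrite -[k.+1]addn1; exists (row_mx B v).
  apply/eqP; rewrite eqn_leq rank_leq_col; apply: leq_trans ltr.
  by rewrite rB addn1.
move=> i; case: (split_ordP i) => j ->.
  by rewrite colKl.
rewrite colKr ord1; suff -> : col 0 v = v by [].
by apply/matrixP => a b; rewrite mxE ord1.
Qed.

(** Among more than [q ^ 5] multiples of a translation, two have fractional parts
    (in the coordinates of [B]) in the same cell of side [1 / q]; discreteness
    makes these fractional parts equal, so a bounded multiple is integral. *)
Lemma translations_commensurable (B : 'M[R]_5) : B \in unitmx ->
  (forall i, translation (col i B)) ->
  exists2 m : nat, (0 < m)%N &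
    forall v, translation v -> forall i, m%:R * (invmx B *m v) i 0 \is a Num.int.
Proof.
move=> Bu LB; have [e e0 De] := translation_discrete.
pose C := 1 + \sum_i \sum_j `|B i j|.
have C0 : 0 < C.
  by rewrite ltr_pwDl // sumr_ge0 // => i _; rewrite sumr_ge0.
(* discreteness transported to the coordinates of [B] *)
have small (d : 'cV[R]_5) : (forall i, `|d i 0| < e / C) -> translation (B *m d) -> d = 0.
  move=> dC LBd; rewrite -(mulKmx Bu d) (De _ LBd) ?mulmx0 // => i.
  rewrite mxE; apply: le_lt_trans (ler_norm_sum _ _ _) _.
  apply: (@le_lt_trans _ _ (\sum_j `|B i j| * (e / C))).
    by apply: ler_sum => j _; rewrite normrM ler_wpM2l // ltW.
  rewrite -mulr_suml mulrCA gtr_pMr // ltr_pdivrMr // mul1r /C.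
  rewrite ltr_pwDl // [leRHS](bigD1 i) //= lerDl sumr_ge0 // => j _.
  by rewrite sumr_ge0.
have LBz (z : 'I_5 -> int) : translation (B *m \col_i (z i)%:~R).
  have -> : B *m \col_i (z i)%:~R = \sum_i col i B *~ z i.
    apply/matrixP => a b; rewrite mxE summxE; apply: eq_bigr => i _.
    by rewrite -scaler_int !mxE mulrC.
  apply: (big_ind translation) => [|x y Lx Ly|i _].
  - exact: translation0.
  - rewrite -[y]opprK; apply: translationB => //; rewrite -sub0r.
    by apply: translationB => //; exact: translation0.
  - exact: translationMz.
have [q q0 qC] : exists2 q : nat, (0 < q)%N & q%:R^-1 < e / C.
  have eC0 : 0 < e / C by rewrite divr_gt0.
  exists (Num.bound (C / e)).+1 => //.
  rewrite -[e / C]invf_div ltf_pV2 ?posrE ?divr_gt0 ?ltr0n //.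
  by rewrite (lt_trans (archi_boundP _)) ?ltr_nat // ltW // divr_gt0.
pose N := (q ^ 5)%N; exists N`!; first exact: fact_gt0.
move=> v Lv; set y := invmx B *m v.
have yE : B *m y = v by rewrite mulKVmx.
clearbody y.
pose fl (k : nat) i := Num.floor (k%:R * y i 0).
pose fr (k : nat) i : R := k%:R * y i 0 - (fl k i)%:~R.
have fr_itv k i : 0 <= fr k i < 1.
  have /andP[lo hi] := floor_itv (k%:R * y i 0).
  by rewrite subr_ge0 lo ltrBlDl -[1]/(1%:~R) -intrD.
have fr_q0 k i : 0 <= q%:R * fr k i by rewrite mulr_ge0 //; case/andP: (fr_itv k i).
have cellP k i : (Num.trunc (q%:R * fr k i) < q)%N.
  rewrite truncn_lt_nat // gtr_pMr ?ltr0n //.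
  by case/andP: (fr_itv k i).
pose cell (k : 'I_N.+1) : {ffun 'I_5 -> 'I_q} :=
  [ffun i => Ordinal (cellP k i)].
have [k [k' [kk' ckk']]] : exists k k' : 'I_N.+1, (k < k')%N /\ cell k = cell k'.
  have /injectivePn[k [k' kk' ckk']] : ~~ injectiveb cell.
    apply/negP => /injectiveP/leq_card.
    by rewrite card_ffun !card_ord ltnn.
  case: (ltngtP k k') => [lt|lt|/val_inj eqk].
  - by exists k, k'.
  - by exists k', k.
  - by rewrite eqk eqxx in kk'.
have Ey : (k' - k)%:R *: y = \col_i (fl k' i - fl k i)%:~R.
  apply/eqP; rewrite -subr_eq0; apply/eqP; apply: small => [i|].
    apply: le_lt_trans qC.
    rewrite !mxE intrB natrB 1?ltnW // mulrBl.
    rewrite (_ : _ - _ = fr k' i - fr k i); last by rewrite /fr; ring.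
    have /ffunP/(_ i) := ckk'; rewrite !ffunE => /(congr1 val) /= tr.
    have /andP[] := truncn_itv (fr_q0 k i); have /andP[] := truncn_itv (fr_q0 k' i).
    rewrite -tr -!natr1 => a1 a2 a3 a4.
    rewrite -[leRHS]mul1r ler_pdivlMr ?ltr0n // -[X in _ * X]normr_nat -normrM.
    by rewrite ler_norml; lra.
  rewrite mulmxBr; apply: translationB => //.
  rewrite -scalemxAr yE scaler_nat; exact: translationMn.
move=> i.
have : (k' - k %| N`!)%N.
  by rewrite dvdn_fact // subn_gt0 kk' -ltnS (leq_ltn_trans (leq_subr _ _)).
move=> /dvdnP[r ->]; rewrite natrM -mulrA.
move/matrixP/(_ i 0): Ey; rewrite mxE [RHS]mxE => ->.
by rewrite rpredM ?natr_int ?intr_int.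
Qed.

(** The powers of [E t] preserve the translations, so by commensurability their
    matrices in the basis [B] have a common denominator [m]. Thus
    [m ^ 5 * (\det (E t)) ^ k] is a nonzero integer for every [k]. *)
Lemma lattice_det_ge1 t u : Gamma (t, u) -> 1 <= `|\det (E t)|.
Proof.
move=> Gt; rewrite leNgt; apply/negP => dlt1.
have [B Bu LB] := translations_basis.
have [m m0 mB] := translations_commensurable Bu LB.
pose X k := m%:R *: (invmx B *m (E t ^+ k *m B)).
have detX k : \det (X k) = m%:R ^+ 5 * \det (E t) ^+ k.
  rewrite /X detZ !det_mulmx det_inv [_^-1 * _]mulrCA mulVf ?mulr1; last first.
    by rewrite -unitfE -unitmxE.
  by congr (_ * _); elim: k => [|k IHk]; rewrite ?det1 // !exprS det_mulmx IHk.
have LX k i : translation (col i (E t ^+ k *m B)).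
  elim: k => [|k IHk]; first by rewrite expr0 mul1mx.
  rewrite exprS -[_ * _]/(_ *m _) -mulmxA col_mulmx; exact: translation_conj Gt _.
have X_int k : \det (X k) \is a Num.int.
  apply: rpred_sum => s _; rewrite rpredM ?rpredX ?rpredN ?rpred1 //.
  apply: rpred_prod => i _; rewrite !mxE.
  have := mB _ (LX k (perm.fun_of_perm s i)) i; rewrite -col_mulmx.
  by rewrite [col _ _ _ _]mxE [X in _ * X]mxE.
have d0 : \det (E t) != 0.
  by rewrite -unitfE -unitmxE; case/mulmx1_unit: (EK t).
have [k kd] : exists k, `|\det (E t)| ^+ k < (m%:R ^+ 5)^-1.
  have /cvgrPdist_lt/(_ (m%:R ^+ 5)^-1) := cvg_expr (dlt1 : `| \det (E t) | < 1).
  rewrite invr_gt0 exprn_gt0 ?ltr0n // => /(_ isT)/filter_ex[k].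
  by rewrite sub0r normrN normrX; exists k.
have := norm_intr_ge1 (X_int k).
rewrite detX mulf_neq0 ?expf_neq0 ?pnatr_eq0 -?lt0n // => /(_ isT).
rewrite normrM !normrX normr_nat leNgt => /negP; apply.
by rewrite -ltr_pdivlMl ?exprn_gt0 ?ltr0n // mulr1.
Qed.
End Lattices.

(** Here [\det (E t) = expR (- (t * l))] cannot be at least one both at [t] and at
    [- t]: the group is not unimodular. *)
Lemma no_lattice_blk (R : realType) (l : R) : l != 0 ->
  ~ (exists Gamma : set (GA R), lattice (blk l 1 (- l)) Gamma).
Proof.
move=> l0 [Gamma latG].
pose E t := mexp (t *: blk l 1 (- l)).
have EE t : E t = blk (expR (t * l)) (t * expR (t * l)) (expR (- (t * l))).
  by rewrite /E mexp_blk mulrN.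
have E0 : E 0 = 1%:M by rewrite EE mul0r oppr0 expR0 mul0r blk1E.
have ED s t : E (s + t) = E s *m E t.
  by rewrite !EE blkM mulrDl opprD !expRD; congr blk; ring.
have Econt : continuous E.
  have -> : E = fun t => blk (expR (t * l)) (t * expR (t * l)) (expR (- (t * l))).
    exact/funext.
  move=> t; have cM : ((s * l) @[s --> t] --> t * l)%classic.
    by apply: cvgMr_tmp; exact: cvg_id.
  have ce : ((expR (s * l)) @[s --> t] --> expR (t * l))%classic.
    exact: (cvg_comp _ _ cM (@continuous_expR R _)).
  apply: cvg_blk => //; first by apply: cvgM => //; exact: cvg_id.
  exact: (cvg_comp _ _ (cvgN cM) (@continuous_expR R _)).
have tl0 (t : R) : t != 0 -> t * l != 0 by move=> t0; rewrite mulf_neq0.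
have exp_neq1 (x : R) : x != 0 -> 1 - expR x != 0.
  by move=> x0; rewrite subr_eq0 eq_sym -expR0 (inj_eq (@expR_inj R)).
have Efix (t : R) : t != 0 -> 1%:M - E t \in unitmx.
  move=> /tl0 t0; rewrite EE -blk1E -scaleN1r blkZ blkD unitmxE det_blk !mulN1r.
  by rewrite unitfE mulf_neq0 ?expf_neq0 ?exp_neq1 ?oppr_eq0.
have Epoly (s t : R) : t != 0 -> exists p : {poly R}, E s = horner_mx (E t) p.
  move=> /[dup] t0 /tl0 tl; rewrite !EE; apply: blk_polynomial.
    by rewrite mulf_neq0 // gt_eqF // expR_gt0.
  rewrite (inj_eq (@expR_inj R)) -subr_eq0 opprK -mulr2n mulrn_eq0.
  exact: tl.
have det_le t u : Gamma (t, u) -> t * l <= 0.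
  move=> /(lattice_det_ge1 E0 ED latG Econt Efix Epoly).
  rewrite -/(E t) EE det_blk -!expRM_natl -expRD ger0_norm ?expR_ge0 //.
  rewrite -[X in X <= _]expR0 ler_expR; lra.
have [t [u [t0 Gt]]] := translation_part_neq0 E0 latG.
have := tl0 _ t0; rewrite eq_le (det_le _ _ Gt) /=.
case: latG => -[_ _ /(_ _ Gt)/det_le /=].
by rewrite mulNr oppr_le0 => ->.
Qed.

(** * The classification *)

Theorem corollary4p5 (R : realType) :
  (forall (c : case_label) (k : nat) (F : family R) (Omega omega : form R[i]),
     representative c k F Omega omega -> pattern F ->
     ~ (exists J, complex_structure (family_mx F) J) ->
     ~ (exists w, symplectic_structure (family_mx F) w) ->
     (form_closed (family_mx F) (spinor Omega omega) <->
      [/\ c = Case6b, k = 2%N &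
        exists lambda alpha : R,
          [/\ F = J2_1_1_1 lambda alpha alpha (- lambda),
              alpha = - lambda & lambda <> 0]]))
  /\
  (forall lambda : R, lambda <> 0 ->
     let F := J2_1_1_1 lambda (- lambda) (- lambda) (- lambda) in
     let A : 'M[R]_5 :=
       jordan 2 lambda ⊕ blk1 (- lambda) ⊕ blk1 (- lambda) ⊕ blk1 (- lambda) in
     let Omega : form R[i] := ('i%C *: \e_0 + \e_2) ∧ (\e_3 + 'i%C *: \e_4) in
     let omega : form R[i] := \e_1 ∧ \e_5 in
     [/\ representative Case6b 2%N F Omega omega /\ family_mx F = A,
         pattern F,
         ~ (exists J, complex_structure A J)
           /\ ~ (exists w, symplectic_structure A w),
         form_closed A (expform ('i%C *: omega) ∧ Omega)
       & ~ (exists Gamma : set (GA R), lattice A Gamma)]).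
Proof.
have AE (l : R) : family_mx (J2_1_1_1 l (- l) (- l) (- l)) = blk l 1 (- l).
  exact: jordan_blk.
split=> [c k F Omega omega rep pat _ _|l /eqP l0 F A Omega omega].
  split; first exact: closed_representative.
  move=> [cE kE [l [a [FE aE l0]]]]; move: cE kE rep; rewrite FE aE AE => -> -> rep.
  inversion rep; subst; exact: exceptional_closed.
have AE' : A = blk l 1 (- l) by exact: jordan_blk.
split.
- by split=> //; apply: (Rep6b_2 (alpha := - l)).
- by apply: exceptional_pattern; apply/eqP.
- rewrite AE'; split; [exact: no_complex_blk | exact: no_symplectic_blk].
- by rewrite AE'; exact: exceptional_closed.
- by rewrite AE'; exact: no_lattice_blk.
Qed.
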